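(* Let $d \ge 2$ and $r\ge 1$ be integers and let $\mathbf{e}=(e_1,\ldots,e_r) \in \{1,\ldots,d-1\}^r$. Then there exists an irreducible affine variety $B=B(d,r,\mathbf{e})$ over $K$ such that for any finite-dimensional $K$-vector space $V$ there are an integer $m \ge 0$ and a surjective map of varieties $B \times \mathbf{A}^m \to \overline{X}_{d,r,\mathbf{e}}(V)$.
   Context: $K$ is an algebraically closed field of characteristic $0$; a variety over $K$ is a reduced, separated scheme of finite type over $K$. For a finite-dimensional $K$-vector space $V$, $S^dV^*$ is the space of homogeneous forms of degree $d$ on $V$, regarded as an affine space over $K$. $X_{d,r,\mathbf{e}}(V)\subseteq S^dV^*$ is the set of all forms $\sum_{i=1}^r g_ih_i$ with $g_i\in S^{e_i}V^*$ and $h_i\in S^{d-e_i}V^*$, and $\overline{X}_{d,r,\mathbf{e}}(V)$ is its Zariski closure in $S^dV^*$. The variety $B$ does not depend on $V$; $m$ and the surjection may. *)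

(* Defs.v *)
From mathcomp Require Export all_boot all_order all_algebra.
From mathcomp Require Export boolp classical_sets functions.
From mathcomp Require Export mpoly.

Set Implicit Arguments.
Unset Strict Implicit.
Unset Printing Implicit Defensive.

Import GRing.Theory.

Local Open Scope classical_set_scope.
Local Open Scope ring_scope.

(* Over an algebraically closed field, affine varieties are handled classically,
   through their K-points: they are the Zariski closed subsets of affine spaces.
   An affine space is a K-module W, always finite-dimensional in the uses below
   ('rV[K]_N, products of these, and spaces of forms), whose coordinate ring
   consists of the polynomials in linear functionals on W. Taking W to be an
   lmodType rather than a vectType is needed since mpoly equips dhomog n K d
   with a vectType structure for n > 0 only. *)
Section Zariski.
Variables (K : fieldType) (W : lmodType K).
Implicit Types (f : W -> K) (X Y Z : set W).

Definition polynomial_fun f : Prop :=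
  exists (k : nat) (l : 'I_k -> {scalar W}) (p : {mpoly K[k]}),
    forall w, f w = p.@[fun i => l i w].

Definition zariski_closed Z : Prop :=
  exists F : set (W -> K),
    F `<=` polynomial_fun /\ Z = [set w | forall f, F f -> f w = 0].

Definition zariski_closure X : set W :=
  [set w | forall Z, zariski_closed Z -> X `<=` Z -> Z w].

Definition irreducible_set X : Prop :=
  X !=set0 /\
  forall Y Z, zariski_closed Y -> zariski_closed Z ->
    X `<=` Y `|` Z -> X `<=` Y \/ X `<=` Z.

Definition irreducible_affine_variety X : Prop :=
  zariski_closed X /\ irreducible_set X.

Definition regular_on X f : Prop :=
  exists2 p : W -> K, polynomial_fun p & forall x, X x -> f x = p x.

End Zariski.

Definition variety_morphism (K : fieldType) (W1 W2 : lmodType K)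
    (X : set W1) (Y : set W2) (phi : W1 -> W2) : Prop :=
  (forall x, X x -> Y (phi x)) /\
  (forall g : W2 -> K, polynomial_fun g -> regular_on X (g \o phi)).

(* S^d V^*, with Sym(V^* ) identified with the polynomial ring in dim V variables
   by means of a basis of V: the variables are the elements of the dual basis. *)
Definition form (K : fieldType) (V : vectType K) (d : nat) :=
  dhomog (\dim {:V}) K d.

Definition strength_set (K : fieldType) (d r : nat) (e : 'I_r -> nat)
    (V : vectType K) : set (form V d) :=
  [set f | exists (g : forall i, form V (e i)) (h : forall i, form V (d - e i)),
     mpoly_of_dhomog f =
       \sum_(i < r) mpoly_of_dhomog (g i) * mpoly_of_dhomog (h i)].

Arguments strength_set {K} d {r} e V.

(* Main.v *)
Require Import Defs.
From HB Require Import structures.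
From mathcomp Require Import all_field zify ring.

Set Implicit Arguments.
Unset Strict Implicit.
Unset Printing Implicit Defensive.

Import GRing.Theory.

Local Open Scope classical_set_scope.
Local Open Scope ring_scope.

(** Let [X(w, p)] be the set of the sums [\sum_i g i * h i] of products of forms of degrees [e i]
    and [d - e i] in [p] variables of weights [w], so that the closure to be
    parametrized is that of [X(1, n)], with [n] the dimension. The point is that there
    is a bound [M], which does not depend on [n], such that every form in the closure
    of [X(1, n)] can be written [P(V_1, ..., V_p)], where [p = d * M], each degree from
    [1] to [d] occurs [M] times among the forms [V_j], and [P] is in the closure of [X(w, p)]
    for [w] the sequence of these degrees ([border_parametrized]). Conversely,
    substituting forms [V_j] of degrees [w_j] maps [X(w, p)] to [X(1, n)], hence one closure
    into the other. So [B] is the closure of [X(w, p)], and the affine space is that of the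
    tuples [V]. [B] is irreducible since two points of [X(w, p)] are joined by a curve in it,
    obtained by moving the factors along segments.

    To find [M], write [F] in the closure of [X(1, n)] as a polynomial in forms, at first as a
    polynomial in itself, and lower the number of forms. Let [F = P(U)] with forms
    [U_j] of degrees [w_j]. There are forms [v_j] of these degrees, depending on [w] only,
    in [q] variables such that [P(v)] in the closure of [X(1, q)] implies [P] in the closure of
    [X(w, p)] ([weights_detect]). If the former fails, some equation [E] of the closure gives
    a polynomial [V |-> E(P(V))] on the tuples of forms in [q] variables that is not
    zero, but vanishes at all tuples obtained from [U] by a linear substitution.
    A relation of this kind of least degree, expanded to first order, shows that one of the [U_j]
    is a polynomial in the other ones and in a bounded number of forms of lower degree
    ([drop_dependent_form]). The numbers of forms of each degree decrease
    lexicographically, so this stops, after a number of steps bounded independently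
    of [F] and [n].

    The forms [v_j] come from replacing a variable of weight [k] by a power sum
    [x_1^k + ... + x_n^k] with [n] large ([powersum_detects]). Suppose that the result is
    a sum of products [g_i h_i]. The coefficients of the factors, with respect to the other
    variables, that have degree not divisible by [k] in [x] are forms in [x] whose number
    and degrees do not depend on [n]. For [n] large they have a common zero [l]
    with [l_1^k + ... + l_n^k = 1] ([isotropic_system]), and at [x = s l] the factors become
    polynomials in [s^k], the power sum becomes [s^k], and [P] is recovered as a sum of
    products. Points of the closure are limits of such sums, so [l] varies with
    the factors and must have a limit. This is why everything is done along a place of
    the ring of functions of the factors ([place_extension]): functions are compared
    by divisibility, and the solution [l] is found bounded. *)

(** * Places on rings of functions *)

(** The graph of a place: [tends a c] says that [a] lies in the valuation ring and
    has residue [c]. Rings of functions have zero divisors; [tends_null] makes a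
    function that vanishes near the place have residue [0]. *)
Record place (K : fieldType) (I : Type) := Place {
  tends :> (I -> K) -> K -> Prop;
  tends_cst : forall c, tends (fun=> c) c;
  tends_add : forall a b c d, tends a c -> tends b d -> tends (a + b) (c + d);
  tends_mul : forall a b c d, tends a c -> tends b d -> tends (a * b) (c * d);
  tends_eq0 : forall c, tends 0 c -> c = 0;
  tends_null : forall a e, tends e 1 -> e * a = 0 -> tends a 0;
  tends_dich : forall a, (exists c, tends a c) \/ tends (fun i => (a i)^-1) 0 }.

Section FunctionPairs.
Variables (K : fieldType) (I : Type).

(** A function together with a candidate for its residue: a partially defined place
    is a subring of this product. *)
Definition fpair := ((I -> K) * K)%type.
HB.instance Definition _ := GRing.ComPzRing.on fpair.

Fact fpair_oner_neq0 : (1 : fpair) != 0.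
Proof. by apply/eqP => /(congr1 snd) /= /eqP; rewrite oner_eq0. Qed.

HB.instance Definition _ :=
  GRing.PzSemiRing_isNonZero.Build fpair fpair_oner_neq0.
HB.instance Definition _ := GRing.ComNzRing.on fpair.

Definition pval (x : fpair) : K := x.2.
Fact pval_zmod_morphism : zmod_morphism pval. Proof. by []. Qed.
Fact pval_monoid_morphism : monoid_morphism pval. Proof. by []. Qed.
HB.instance Definition _ :=
  GRing.isZmodMorphism.Build fpair K pval pval_zmod_morphism.
HB.instance Definition _ :=
  GRing.isMonoidMorphism.Build fpair K pval pval_monoid_morphism.

Definition indic (N : set I) : I -> K := fun t => (`[< N t >])%:R.

End FunctionPairs.

Section Chevalley.
Variables (K : closedFieldType) (I : Type).
Local Notation AK := (fpair K I).
Implicit Types (G : set AK) (a b : I -> K).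

Definition partial_hom G := [/\ forall c : K, G ((fun=> c), c),
  forall x y : AK, G x -> G y -> G (x + y),
  forall x y : AK, G x -> G y -> G (x * y) &
  forall c, G (0, c) -> c = 0].

Lemma partial_hom_maximal G0 : partial_hom G0 ->
  exists G, [/\ G0 `<=` G, partial_hom G &
     forall G', partial_hom G' -> G `<=` G' -> G' `<=` G].
Proof.
move=> ok0.
pose P : set (set AK) := [set A | partial_hom (A `|` G0)].
have chain (F : set (set AK)) : F `<=` P -> total_on F subset -> P (\bigcup_(X in F) X).
  move=> FP Ftot; rewrite /P /=; set U := \bigcup_(X in F) X.
  have sub X : F X -> X `|` G0 `<=` U `|` G0.
    by move=> FX x [Xx|]; [left; exists X | right].
  have get x y : (U `|` G0) x -> (U `|` G0) y ->
      exists H, [/\ partial_hom H, H `<=` U `|` G0, H x & H y].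
    move=> [[X FX Xx]|G0x] [[Y FY Yy]|G0y].
    - have [XY|YX] := Ftot _ _ FX FY.
        by exists (Y `|` G0); split; [apply: FP|apply: sub|left; apply: XY|left].
      by exists (X `|` G0); split; [apply: FP|apply: sub|left|left; apply: YX].
    - by exists (X `|` G0); split; [apply: FP|apply: sub|left|right].
    - by exists (Y `|` G0); split; [apply: FP|apply: sub|right|left].
    - by exists G0; split=> // x0; right.
  case: (ok0) => [c0 _ _ _]; split.
  - by move=> c; right.
  - by move=> x y /get /[apply] -[H [[_ ad _ _] HU Hx Hy]]; apply/HU/ad.
  - by move=> x y /get /[apply] -[H [[_ _ mu _] HU Hx Hy]]; apply/HU/mu.
  - by move=> c Uc; have [H [[_ _ _ z] _ Hc _]] := get _ _ Uc Uc; apply: z.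
have [A [PA Amax]] := Zorn_bigcup chain.
exists (A `|` G0); split=> // G' okG' AG' x G'x.
apply: contrapT => nAx; apply: (Amax G').
  split; first by move=> y Ay; apply: AG'; left.
  by move=> /(_ _ G'x) Ax; apply: nAx; left.
rewrite /P /=; suff -> : G' `|` G0 = G' by [].
by apply/seteqP; split=> y; [case=> // G0y; apply: AG'; right|left].
Qed.

Section Maximal.
Variables (G : set AK) (okG : partial_hom G).
Hypothesis maxG : forall G', partial_hom G' -> G `<=` G' -> G' `<=` G.

Let Gc (c : K) : G ((fun=> c), c). Proof. by case: okG. Qed.
Let GD (x y : AK) : G x -> G y -> G (x + y). Proof. by case: okG => _ + _ _; apply. Qed.
Let GM (x y : AK) : G x -> G y -> G (x * y). Proof. by case: okG => _ _ + _; apply. Qed.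
Let G0P c : G (0, c) -> c = 0. Proof. by case: okG => _ _ _; apply. Qed.
Let G0 : G 0. Proof. exact: Gc. Qed.
Let G1 : G 1. Proof. exact: Gc. Qed.
Let GN (x : AK) : G x -> G (- x).
Proof. by move=> Gx; rewrite -mulN1r; apply: GM => //; apply: (Gc (-1)). Qed.
Let Gsum (J : Type) (r : seq J) (P : pred J) (F : J -> AK) :
  (forall j, P j -> G (F j)) -> G (\sum_(j <- r | P j) F j).
Proof. by move=> GF; apply: big_ind. Qed.

Let GMp a b c d : G (a, c) -> G (b, d) -> G (a * b, c * d).
Proof. exact: GM. Qed.
Let GBp a b c d : G (a, c) -> G (b, d) -> G (a - b, c - d).
Proof. by move=> Ga Gb; apply: GD Ga (GN Gb). Qed.
Let mulE (x y : AK) : x * y = (x.1 * y.1, x.2 * y.2). Proof. by []. Qed.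

Definition Gpoly (f : {poly AK}) := forall i, G f`_i.

Let GpC (x : AK) : G x -> Gpoly x%:P.
Proof. by move=> Gx i; rewrite coefC; case: eqP. Qed.
Let GpX : Gpoly 'X.
Proof. by move=> i; rewrite coefX; case: eqP. Qed.
Let GpD f g : Gpoly f -> Gpoly g -> Gpoly (f + g).
Proof. by move=> Gf Gg i; rewrite coefD; apply: GD. Qed.
Let GpM f g : Gpoly f -> Gpoly g -> Gpoly (f * g).
Proof. by move=> Gf Gg i; rewrite coefM; apply: Gsum => j _; apply: GM. Qed.

Let fstE (f : {poly AK}) a c :
  (f.[(a, c) : AK]).1 = fun t => \sum_(j < size f) (f`_j).1 t * a t ^+ j.
Proof.
have fstX (x : AK) n t : (x ^+ n).1 t = x.1 t ^+ n.
  by elim: n => // n IH; rewrite !exprS -IH.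
rewrite horner_coef (raddf_sum (@fst (I -> K) K)); apply: funext => t.
rewrite fct_sumE; apply: eq_bigr => j _.
by rewrite -(fstX (a, c)).
Qed.

Let fstH (f : {poly AK}) a c c' : (f.[(a, c) : AK]).1 = (f.[(a, c') : AK]).1.
Proof. by rewrite !fstE. Qed.

(** The relations of [a] over [G], read on residues, form an ideal of [K[X]]. A root
    of that ideal could be taken as the value of [a], against maximality, so the
    ideal contains [1]. *)
Lemma not_tends_relation a : (forall c, ~ G (a, c)) ->
  exists f : {poly AK}, [/\ Gpoly f, (f.[(a, 0) : AK]).1 = 0 &
    forall i, (f`_i).2 = (i == 0%N)%:R].
Proof.
move=> na.
pose J (p : {poly K}) := exists f : {poly AK}, [/\ Gpoly f, (f.[(a, 0) : AK]).1 = 0 &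
    map_poly (@pval K I) f = p].
have JM p q : J p -> J (q * p).
  case=> f [Gf f0 <-].
  pose h := map_poly (fun c : K => ((fun=> c), c) : AK) q.
  have hE i : h`_i = ((fun=> q`_i), q`_i) by rewrite coef_map_id0.
  exists (h * f); split.
  - by apply: GpM => // i; rewrite hE.
  - by rewrite hornerM /= f0 mulr0.
  - rewrite rmorphM /=; congr (_ * _); apply/polyP=> i.
    by rewrite coef_map /= hE.
have JD p q : J p -> J q -> J (p + q).
  case=> f [Gf f0 <-] [g [Gg g0 <-]]; exists (f + g); split.
  - exact: GpD.
  - by rewrite hornerD /= f0 g0 addr0.
  - by rewrite rmorphD.
have [J1|nJ1] := pselect (J 1).
  have [f [Gf f0 fE]] := J1; exists f; split=> // i.
  by have := congr1 (fun p : {poly K} => p`_i) fE; rewrite coef_map coef1.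
suff [c cJ] : exists c, forall p, J p -> p.[c] = 0.
  pose G' := [set x : AK | exists2 f, Gpoly f & x = f.[(a, c) : AK]].
  have G'a : G' (a, c) by exists 'X => //; rewrite hornerX.
  have GG' : G `<=` G'.
    by move=> x Gx; exists x%:P; rewrite ?hornerC //; apply: GpC.
  case: (na c); apply: (maxG _ GG' G'a); split.
  - by move=> k; apply: GG'.
  - by move=> x y [f Gf ->] [g Gg ->]; exists (f + g); rewrite ?hornerD //; apply: GpD.
  - by move=> x y [f Gf ->] [g Gg ->]; exists (f * g); rewrite ?hornerM //; apply: GpM.
  - move=> k [f Gf fk].
    have := cJ (map_poly (@pval K I) f); rewrite -{1}[c]/(pval ((a, c) : AK)) horner_map /= -fk /=.
    by apply; exists f; split=> //; rewrite (fstH _ a 0 c) -fk.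
have [[p [Jp p0]]|nJ] := pselect (exists p, J p /\ p != 0); last first.
  exists 0 => p Jp; have [->|p0] := eqVneq p 0; first by rewrite horner0.
  by case: nJ; exists p.
have [m [q Jq [q0 qm]] qmin] : exists2 m, (exists2 q, J q & q != 0 /\ size q = m) &
    forall q, J q -> q != 0 -> (m <= size q)%N.
  pose Q m := `[< exists2 q, J q & q != 0 /\ size q = m >].
  have exQ : exists m, Q m by exists (size p); apply/asboolP; exists p.
  have [m /asboolP Qm mmin] := ex_minnP exQ; exists m => // q Jq q0.
  by apply: mmin; apply/asboolP; exists q.
have qdvd p' : J p' -> q %| p'.
  move=> Jp'; apply/modp_eq0P/eqP; apply: contraTT isT => r0.
  have Jr : J (p' %% q).
    rewrite [X in J X](_ : _ = p' + (- (p' %/ q)) * q); first exact/JD/JM.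
    by rewrite {2}(divp_eq p' q) mulNr addrC addKr.
  by have := qmin _ Jr r0; rewrite -qm leqNgt ltn_modp q0.
have /closed_rootP[c /eqP qc] : size q != 1%N.
  apply/eqP => /eqP/size_poly1P[k k0 qE]; apply: nJ1.
  by have := JM _ (k^-1)%:P Jq; rewrite qE -polyCM mulVf.
by exists c => p' /qdvd /dvdpP[h ->]; rewrite hornerM qc mulr0.
Qed.

(** Multiplied by [e], a relation of [a] keeps only its constant term, whose residue
    is [1]. *)
Lemma maximal_null a (e : I -> K) : G (e, 1) -> e * a = 0 -> G (a, 0).
Proof.
move=> Ge ea0; have [[c Gac]|na] := pselect (exists c, G (a, c)).
  suff c0 : c = 0 by rewrite -c0.
  by apply: G0P; have := GMp Ge Gac; rewrite ea0 mul1r.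
have [|f [Gf f0 fE]] := @not_tends_relation a; first by move=> c ?; apply: na; exists c.
have : G ((e, 1) * f`_0) by apply: GM.
suff -> : (e, 1) * f`_0 = (0, 1) :> AK by move/G0P/eqP; rewrite oner_eq0.
have eat t : e t * a t = 0 by have := congr1 (fun h => h t) ea0.
rewrite mulE fE mul1r; congr (_, _); apply: funext => t.
transitivity (e t * (f.[(a, 0) : AK]).1 t); last by rewrite f0 mulr0.
rewrite fstE mulr_sumr; have [->|sf] := eqVneq f 0.
  by rewrite coef0 size_poly0 big_ord0; apply: mulr0.
rewrite -(prednK (_ : 0 < size f)%N) ?lt0n ?size_poly_eq0 //.
rewrite big_ord_recl expr0 mulr1 big1 ?addr0 // => j _.
transitivity (e t * a t * ((f`_j.+1).1 t * a t ^+ j)); first by rewrite exprS /=; ring.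
by rewrite eat mul0r.
Qed.

(** On an idempotent [x] a relation reads [f_0 + x s = 0] with [s] of residue [0], so
    [f_0 (f_0 + s)] vanishes although its residue is [1]. *)
Lemma maximal_indic (N : set I) : G (indic K N, 1) \/ G (1 - indic K N, 1).
Proof.
set x := indic K N; have xx : x * x = x.
  by apply: funext => t; rewrite -[(x * x) t]/(x t * x t) /x /indic -natrM mulnb andbb.
have [[c Gxc]|nx] := pselect (exists c, G (x, c)).
  have := GBp (GMp Gxc Gxc) Gxc; rewrite xx subrr.
  move=> /G0P/eqP; rewrite -{3}[c]mulr1 -mulrBr mulf_eq0 subr_eq0 => /orP[] /eqP cE.
    by right; have := GBp G1 Gxc; rewrite cE subr0.
  by left; rewrite cE in Gxc.
have [|f [Gf f0 fE]] := @not_tends_relation x; first by move=> c ?; apply: nx; exists c.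
pose s := \sum_(0 <= j < (size f).-1) f`_j.+1.
have Gs : G s by apply: Gsum.
have s2 : s.2 = 0.
  by rewrite /s (raddf_sum (@pval K I)) big1 // => j _; rewrite -[LHS]/(f`_j.+1).2 fE.
have : G (f`_0 * (f`_0 + s)) by apply/GM/GD.
suff -> : f`_0 * (f`_0 + s) = (0, 1) :> AK by move/G0P/eqP; rewrite oner_eq0.
have sz : (0 < size f)%N.
  rewrite lt0n size_poly_eq0; apply/eqP => fz; have /eqP := fE 0%N.
  by rewrite fz coef0 eq_sym oner_eq0.
have fx t : (f`_0).1 t = - (x t * s.1 t).
  apply/eqP; rewrite -subr_eq0 opprK; apply/eqP.
  rewrite -[RHS](_ : (f.[(x, 0) : AK]).1 t = 0); last by rewrite f0.
  rewrite fstE -(prednK sz) big_ord_recl expr0 mulr1; congr (_ + _).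
  rewrite /s (raddf_sum (@fst (I -> K) K)) fct_sumE big_mkord mulr_sumr.
  apply: eq_bigr => j _; rewrite mulrC; congr (_ * _).
  have xxt : x t * x t = x t by have := congr1 (fun h => h t) xx.
  by rewrite lift0; elim: (nat_of_ord j) => // k IH; rewrite exprS -IH xxt.
rewrite mulE -[(_ + _).2]/(_.2 + _.2) fE s2 addr0 mulr1; congr (_, _); apply: funext => t.
have xxt : x t * x t = x t by have := congr1 (fun h => h t) xx.
rewrite -[LHS]/((f`_0).1 t * ((f`_0).1 t + s.1 t)) fx.
transitivity ((x t * x t - x t) * s.1 t * s.1 t); first by ring.
by rewrite xxt subrr !mul0r.
Qed.

(** A relation of degree at most [n] valid on [N], with coefficients of residues
    [1, 0, 0, ...]. Relations for [a] and for its inverse exclude each other: as for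
    any valuation ring, the one of smaller degree, multiplied by a power, eliminates
    the top coefficient of the other, and no relation on a large [N] has degree [0]. *)
Definition descent_relation (N : set I) (a : I -> K) n := exists b : nat -> AK,
  [/\ forall j, G (b j), forall j, (b j).2 = (j == 0%N)%:R,
      forall j, (n < j)%N -> b j = 0 &
      forall t, N t -> \sum_(j < n.+1) (b j).1 t * a t ^+ j = 0].

Lemma descent_step (N : set I) a a' p q : (forall t, N t -> a t * a' t = 1) ->
  (q <= p.+1)%N ->
  descent_relation N a p.+1 -> descent_relation N a' q -> descent_relation N a p.
Proof.
move=> aa qp [b [Gb b2 bz b0]] [b' [Gb' b'2 b'z b'0]].
exists (fun i => if (i <= p)%N then b' 0%N * b i - b p.+1 * b' (p.+1 - i)%N else 0).
split.
- by move=> j; case: ifP => // _; apply/GD/GN/GM => //; apply: GM.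
- move=> j; case: ifPn => [jp|]; last by rewrite -ltnNge; case: j.
  rewrite -[LHS]/((b' 0%N).2 * (b j).2 - (b p.+1).2 * (b' (p.+1 - j)%N).2).
  by rewrite !b2 !b'2 /= mul1r mul0r subr0.
- by move=> j; rewrite ltnNge => /negbTE ->.
move=> t Nt; set x := a t; set y := a' t.
have H1 : \sum_(i < p.+2) (b' (p.+1 - i)%N).1 t * x ^+ i = 0.
  have : x ^+ p.+1 * \sum_(j < p.+2) (b' j).1 t * y ^+ j = 0.
    suff -> : \sum_(j < p.+2) (b' j).1 t * y ^+ j = 0 by rewrite mulr0.
    rewrite -[RHS](b'0 t Nt) [RHS](big_ord_widen p.+2 (fun j => (b' j).1 t * y ^+ j)) //.
    rewrite [RHS]big_mkcond; apply: eq_bigr => i _; case: ifPn => //.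
    by rewrite -leqNgt => /b'z ->; apply: mul0r.
  move=> H; rewrite -[RHS]H mulr_sumr (reindex_inj rev_ord_inj) /=; apply: eq_bigr => j _.
  have jp := ltn_ord j; rewrite subSS subKn -1?ltnS // mulrCA; congr (_ * _).
  have -> : x ^+ p.+1 = x ^+ (p.+1 - j) * x ^+ j by rewrite -exprD subnK // -ltnS.
  by rewrite -mulrA -exprMn aa // expr1n mulr1.
transitivity ((b' 0%N).1 t * (\sum_(i < p.+2) (b i).1 t * x ^+ i)
   - (b p.+1).1 t * (\sum_(i < p.+2) (b' (p.+1 - i)%N).1 t * x ^+ i)); last first.
  by rewrite H1 b0 // !mulr0 subrr.
rewrite !mulr_sumr -sumrB [in RHS]big_ord_recr /= subnn.
set z := (X in _ = _ + X); have -> : z = 0 by rewrite /z; ring.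
rewrite addr0; apply: eq_bigr => i _; rewrite -ltnS ltn_ord.
rewrite -[(_ - _).1 t]/((b' 0%N).1 t * (b i).1 t - (b p.+1).1 t * (b' (p.+1 - i)%N).1 t).
by ring.
Qed.

Lemma descent_relation_false (N : set I) a a' p q : G (indic K N, 1) ->
  (forall t, N t -> a t * a' t = 1) ->
  descent_relation N a p -> descent_relation N a' q -> False.
Proof.
move=> GN1; have zero c : ~ descent_relation N c 0.
  case=> b [Gb b2 _ b0]; have : G ((indic K N, 1) * b 0%N) by apply: GM.
  suff -> : (indic K N, 1) * b 0%N = (0, 1) :> AK by move/G0P/eqP; rewrite oner_eq0.
  rewrite mulE b2 mul1r; congr pair; apply: funext => t.
  rewrite -[LHS]/(indic K N t * (b 0%N).1 t) /indic; case: asboolP => Nt; rewrite ?mul0r //.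
  by have := b0 t Nt; rewrite big_ord_recl big_ord0 addr0 expr0 mulr1 mul1r.
move: {2}(p + q)%N (leqnn (p + q)) => k; elim: k a a' p q => [|k IH] a a' p q pq aa R1 R2.
  by move: R1; rewrite (_ : p = 0%N); [move/zero | lia].
case: p R1 pq => [/zero//|p] R1; case: q R2 => [/zero//|q] R2 pq.
have [qp|pq'] := leqP q.+1 p.+1.
  by apply: (IH _ _ p q.+1 _ aa _ R2); [lia | exact: descent_step qp R1 R2].
apply: (IH _ _ p.+1 q _ aa R1); first lia.
by apply: descent_step R2 R1; [move=> t /aa; rewrite mulrC | exact: ltnW].
Qed.

(** If neither [a] nor its inverse has a value, both satisfy a relation, and the descent
    applies. If the inverse has the value [c], a relation of [a] times a high
    power of the inverse shows that some power of [c] is zero. *)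
Lemma maximal_dichotomy a : (exists c, G (a, c)) \/ G (fun t => (a t)^-1, 0).
Proof.
have [|na] := pselect (exists c, G (a, c)); first by left.
right; set a' := fun t => _; pose N := [set t | a t != 0].
have [f [Gf f0 fE]] : exists f : {poly AK}, [/\ Gpoly f, (f.[(a, 0) : AK]).1 = 0 &
    forall i, (f`_i).2 = (i == 0%N)%:R].
  by apply: not_tends_relation => c ?; apply: na; exists c.
have aa t : N t -> a t * a' t = 1 by move=> Nt; rewrite /a' mulfV.
have [GN1|GN1] := maximal_indic N; last first.
  case: na; exists 0; apply: maximal_null GN1 _; apply: funext => t.
  rewrite -[LHS]/((1 - indic K N t) * a t) /indic; case: asboolP; first by rewrite subrr mul0r.
  by move=> /negP; rewrite negbK => /eqP ->; rewrite mulr0.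
have rel c (h : {poly AK}) : Gpoly h -> (h.[(c, 0) : AK]).1 = 0 ->
    (forall i, (h`_i).2 = (i == 0%N)%:R) -> descent_relation N c (size h).
  move=> Gh h0 hE; exists (fun i => h`_i); split=> //.
    by move=> j /ltnW hj; apply: nth_default.
  move=> t _; rewrite big_ord_recr /= [h`__]nth_default // -[(0 : AK).1]/(0 : I -> K).
  by rewrite mul0r addr0; have := congr1 (fun z => z t) h0; rewrite fstE.
have [[c Gc']|na'] := pselect (exists c, G (a', c)); last first.
  have [|g [Gg g0 gE]] := @not_tends_relation a'; first by move=> c ?; apply: na'; exists c.
  by case: (descent_relation_false GN1 aa (rel _ _ Gf f0 fE) (rel _ _ Gg g0 gE)).
suff c0 : c = 0 by rewrite -c0.
have GXp n : G (a' ^+ n, c ^+ n).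
  by elim: n => [|n IH]; [exact: G1 | rewrite !exprS; exact: GMp].
set n := size f.
have : G (\sum_(j < n) f`_j * (a' ^+ (n - j)%N, c ^+ (n - j)%N)).
  by apply: Gsum => j _; apply: GM.
have n0 : (0 < n)%N.
  rewrite lt0n size_poly_eq0; apply/eqP => fz; have /eqP := fE 0%N.
  by rewrite fz coef0 eq_sym oner_eq0.
rewrite [X in G X](_ : _ = (0, c ^+ n)); last first.
  have pairP (x y : AK) : x.1 = y.1 -> x.2 = y.2 -> x = y.
    by case: x y => [? ?] [? ?] /= -> ->.
  apply: pairP.
    rewrite (raddf_sum (@fst (I -> K) K)) fct_sumE; apply: funext => t.
    have ft : \sum_(j < n) (f`_j).1 t * a t ^+ j = 0.
      by have := congr1 (fun z => z t) f0; rewrite fstE.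
    have [at0|Nt] := eqVneq (a t) 0.
      rewrite big1 // => j _; rewrite mulE -[LHS]/((f`_j).1 t * (a' ^+ (n - j)%N) t).
      have -> : (a' ^+ (n - j)%N) t = 0; last exact: mulr0.
      rewrite (_ : (n - j)%N = (n - j).-1.+1) ?exprS; last by have := ltn_ord j; lia.
      by rewrite -[LHS]/(a' t * _ t) /a' at0 invr0 mul0r.
    transitivity (a' t ^+ n * \sum_(j < n) (f`_j).1 t * a t ^+ j); last by rewrite ft mulr0.
    rewrite mulr_sumr; apply: eq_bigr => j _.
    have aX k : (a' ^+ k) t = a' t ^+ k by elim: k => // k IH; rewrite !exprS -IH.
    rewrite mulE -[LHS]/((f`_j).1 t * (a' ^+ (n - j)%N) t) aX mulrCA; congr (_ * _).
    have -> : a' t ^+ n = a' t ^+ (n - j) * a' t ^+ j by rewrite -exprD subnK // ltnW.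
    by rewrite -mulrA -exprMn mulrC [_ * a t]mulrC aa // expr1n mul1r.
  rewrite -[LHS]/(pval _) raddf_sum -(prednK n0) big_ord_recl big1 ?addr0.
    by rewrite /pval mulE fE mul1r subn0.
  by move=> j _; rewrite /pval mulE fE mul0r.
by move=> /G0P/eqP; rewrite expf_eq0 => /andP[_ /eqP].
Qed.

End Maximal.

(** Chevalley's extension theorem for rings of functions; the residue field does not
    grow because [K] is algebraically closed. *)
Theorem place_extension G0 : partial_hom G0 ->
  exists P : place K I, forall a c, G0 (a, c) -> P a c.
Proof.
move=> /partial_hom_maximal[G [G0G okG maxG]]; case: (okG) => Gc GD GM Gz.
unshelve eexists (@Place K I (fun a c => G (a, c)) Gc _ _ Gz _ _).
- by move=> a b c d Ga Gb; apply: GD Ga Gb.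
- by move=> a b c d Ga Gb; apply: GM Ga Gb.
- exact: maximal_null.
- exact: maximal_dichotomy.
- by move=> a c /G0G.
Qed.

End Chevalley.

(** * Limits along a place *)

Section PlaceTheory.
Variables (K : fieldType) (I : Type) (P : place K I).
Implicit Types (a b : I -> K) (c d : K) (N M : set I).

Lemma tends0 : P 0 0. Proof. exact: tends_cst. Qed.

Lemma tends1 : P 1 1. Proof. exact: tends_cst. Qed.

Lemma tends_opp a c : P a c -> P (- a) (- c).
Proof. by move=> Pac; rewrite -mulN1r -[- c]mulN1r; exact: tends_mul (tends_cst P (-1)) Pac. Qed.

Lemma tends_sub a b c d : P a c -> P b d -> P (a - b) (c - d).
Proof. by move=> Pa Pb; apply/tends_add/tends_opp. Qed.

Lemma tends_exp a c n : P a c -> P (a ^+ n) (c ^+ n).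
Proof.
by move=> Pa; elim: n => [|n IH]; [exact: tends1 | rewrite !exprS; exact: tends_mul].
Qed.

Lemma tends_uniq a c d : P a c -> P a d -> c = d.
Proof.
move=> Pc /(tends_sub Pc); rewrite subrr => /tends_eq0/eqP.
by rewrite subr_eq0 => /eqP.
Qed.

Definition bounded a := exists c, P a c.

(** The sets whose indicator has residue [1] form an ultrafilter, on which the place
    depends: what holds on a large set may be assumed everywhere. *)
Definition large N := P (indic K N) 1.

Lemma largeS N M : N `<=` M -> large N -> large M.
Proof.
rewrite /large => NM PN.
suff : P (indic K M - 1) (1 - 1) by move=> /tends_add /(_ tends1); rewrite !subrK.
rewrite subrr; apply: tends_null PN _; apply: funext => t.
rewrite -[LHS]/(indic K N t * (indic K M t - 1)) /indic.
case: asboolP => Nt; rewrite ?mul0r //; case: asboolP => [_|/(_ (NM _ Nt)) //].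
by rewrite subrr mulr0.
Qed.

Lemma largeT : large setT.
Proof.
rewrite /large; suff -> : indic K (@setT I) = 1 by exact: tends1.
by apply: funext => t; rewrite /indic; case: asboolP => // -[].
Qed.

Lemma largeI N M : large N -> large M -> large (N `&` M).
Proof.
rewrite /large => /tends_mul /[apply]; rewrite mul1r; congr (P _ _).
apply: funext => t; rewrite -[LHS]/(indic K N t * indic K M t) /indic.
by do !case: asboolP; rewrite ?(mulr0, mulr1) //; firstorder.
Qed.

Lemma large_or N : large N \/ large (~` N).
Proof.
set x := indic K N; have xx : x * x = x.
  by apply: funext => t; rewrite -[LHS]/(x t * x t) /x /indic -natrM mulnb andbb.
have xC : 1 - x = indic K (~` N).
  apply: funext => t; rewrite -[LHS]/(1 - x t) /x /indic.
  by do !case: asboolP => //; rewrite ?(subrr, subr0) //; firstorder.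
have xV : (fun t => (x t)^-1) = x.
  by apply: funext => t; rewrite /x /indic; case: asboolP; rewrite ?(invr1, invr0).
have c0 c : P x c -> c = 0 -> large (~` N).
  by move=> Pxc cE; have := tends_sub tends1 Pxc; rewrite cE subr0 xC.
have [[c Pxc]|] := tends_dich P x; last first.
  by rewrite xV => Px; right; apply: c0 Px _.
have := tends_sub (tends_mul Pxc Pxc) Pxc; rewrite xx subrr => /tends_eq0/eqP.
rewrite -{3}[c]mulr1 -mulrBr mulf_eq0 subr_eq0 => /orP[] /eqP cE.
  by right; apply: c0 Pxc cE.
by left; rewrite /large -{1}cE.
Qed.

Lemma tends_large N a b c : large N -> (forall t, N t -> a t = b t) -> P a c -> P b c.
Proof.
move=> PN ab Pa; suff : P (b - a) 0 by move=> /tends_add /(_ Pa); rewrite subrK add0r.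
apply: tends_null PN _; apply: funext => t.
rewrite -[LHS]/(indic K N t * (b t - a t)) /indic.
by case: asboolP => [/ab ->|_]; rewrite ?(subrr, mulr0, mul0r).
Qed.

Lemma tends_sum (J : Type) (r : seq J) (Q : pred J) (F : J -> I -> K) (f : J -> K) :
  (forall j, Q j -> P (F j) (f j)) ->
  P (fun t => \sum_(j <- r | Q j) F j t) (\sum_(j <- r | Q j) f j).
Proof.
move=> PF; rewrite (_ : (fun t => _) = \sum_(j <- r | Q j) F j); last first.
  by apply: funext => t; rewrite fct_sumE.
apply: (big_rec2 (fun a c => P a c)); first exact: tends0.
by move=> j a c Qj; apply/tends_add/PF.
Qed.

Lemma tends_prod (J : Type) (r : seq J) (Q : pred J) (F : J -> I -> K) (f : J -> K) :
  (forall j, Q j -> P (F j) (f j)) ->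
  P (fun t => \prod_(j <- r | Q j) F j t) (\prod_(j <- r | Q j) f j).
Proof.
move=> PF; rewrite (_ : (fun t => _) = \prod_(j <- r | Q j) F j); last first.
  by apply: funext => t; rewrite fct_prodE.
apply: (big_rec2 (fun a c => P a c)); first exact: tends1.
by move=> j a c Qj; apply/tends_mul/PF.
Qed.

Lemma tends_meval k (p : {mpoly K[k]}) (F : 'I_k -> I -> K) (c : 'I_k -> K) :
  (forall j, P (F j) (c j)) -> P (fun t => p.@[fun j => F j t]) (p.@[c]).
Proof.
move=> Fc; rewrite mevalE (_ : (fun t => _) = fun t =>
    \sum_(m <- msupp p) p@_m * \prod_j F j t ^+ m j).
  apply: tends_sum => m _; apply: tends_mul (tends_cst P _) _; apply: tends_prod => j _.
  rewrite (_ : (fun t => _) = F j ^+ m j); first exact: tends_exp.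
  by apply: funext => t; elim: (m j) => // a IH; rewrite !exprS IH.
by apply: funext => t; rewrite mevalE.
Qed.

(** The valuation ring orders functions by divisibility, totally. *)
Lemma bounded_dich a b : exists2 c, bounded c &
  large [set t | b t = c t * a t] \/ large [set t | a t = c t * b t].
Proof.
have nz f : ~ large [set t | f t = 0] -> large [set t | f t != 0].
  move=> nf; have [//|] := large_or [set t | f t = 0].
  by apply: largeS => t /eqP.
have [a0|/nz a0] := pselect (large [set t | a t = 0]).
  exists 0; first by exists 0; apply: tends0.
  by right; apply: largeS a0 => t /= ->; rewrite mul0r.
have [b0|/nz b0] := pselect (large [set t | b t = 0]).
  exists 0; first by exists 0; apply: tends0.
  by left; apply: largeS b0 => t /= ->; rewrite mul0r.
have [ba|ab] := tends_dich P (fun t => b t / a t).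
  exists (fun t => b t / a t) => //; left; apply: largeS a0 => t /= a0.
  by rewrite divfK.
exists (fun t => (b t / a t)^-1); first by exists 0.
by right; apply: largeS b0 => t /= b0; rewrite invf_div divfK.
Qed.

(** Bounded functions are integrally closed. *)
Lemma bounded_root s n : (0 < n)%N -> bounded (s ^+ n) -> bounded s.
Proof.
move=> n0 [c Pc]; have [//|sV] := tends_dich P s.
have [s0|sN0] := large_or [set t | s t = 0].
  by exists 0; apply: tends_large s0 _ tends0 => t /= ->.
have := tends_mul (tends_exp n sV) Pc; rewrite expr0n eqn0Ngt n0 mul0r => P0.
have fX (f : I -> K) k t : (f ^+ k) t = f t ^+ k.
  by elim: k => // k IH; rewrite !exprS -IH.
have /(tends_uniq tends1)/eqP : P 1 0; last by rewrite oner_eq0.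
apply: tends_large sN0 _ P0 => t /= /eqP st.
by rewrite -[LHS]/((_ ^+ n) t * (s ^+ n) t) !fX -exprMn mulVf // expr1n.
Qed.

End PlaceTheory.

(** * Splitting the variables of a polynomial into two groups *)

Section Splitting.
Variables (n m : nat).

Definition mleft (M : 'X_{1..n + m}) : 'X_{1..n} := [multinom M (lshift m i) | i < n].
Definition mright (M : 'X_{1..n + m}) : 'X_{1..m} := [multinom M (rshift n i) | i < m].

Definition vjoin (T : Type) (x : 'I_n -> T) (y : 'I_m -> T) (i : 'I_(n + m)) : T :=
  match fintype.split i with inl a => x a | inr b => y b end.

Lemma vjoinl T (x : 'I_n -> T) y i : vjoin x y (lshift m i) = x i.
Proof. by rewrite /vjoin (unsplitK (inl i)). Qed.

Lemma vjoinr T (x : 'I_n -> T) (y : 'I_m -> T) i : vjoin x y (rshift n i) = y i.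
Proof. by rewrite /vjoin (unsplitK (inr i)). Qed.

Lemma mdeg_split M : mdeg M = (mdeg (mleft M) + mdeg (mright M))%N.
Proof.
by rewrite !mdegE big_split_ord; congr (_ + _)%N; apply: eq_bigr => i _; rewrite mnmE.
Qed.

Lemma mleft_rightP M M' : mleft M = mleft M' -> mright M = mright M' -> M = M'.
Proof.
move=> /mnmP ll /mnmP rr; apply/mnmP => i; rewrite -(splitK i).
by case: (fintype.split i) => j /=; [have := ll j | have := rr j]; rewrite !mnmE.
Qed.

Variable K : fieldType.
Implicit Types (G : {mpoly K[n + m]}) (x : 'I_n -> K) (y : 'I_m -> K).

Lemma meval_split G x y : G.@[vjoin x y] =
  \sum_(M <- msupp G) G@_M * \prod_i x i ^+ mleft M i * \prod_i y i ^+ mright M i.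
Proof.
rewrite mevalE; apply: eq_bigr => M _; rewrite -mulrA; congr (_ * _).
rewrite big_split_ord; congr (_ * _); apply: eq_bigr => i _.
  by rewrite vjoinl mnmE.
by rewrite vjoinr mnmE.
Qed.

(** The polynomials in [n + m] variables are viewed as polynomials in the last [m] ones
    over the ring of polynomials in the first [n] ones. *)
Definition xcoef G (b : 'X_{1..m}) : {mpoly K[n]} :=
  \sum_(M <- msupp G | mright M == b) G@_M *: 'X_[mleft M].

Definition xeval G x : {mpoly K[m]} :=
  \sum_(M <- msupp G) (G@_M * \prod_i x i ^+ mleft M i) *: 'X_[mright M].

Lemma mcoeff_xeval G x b : (xeval G x)@_b = (xcoef G b).@[x].
Proof.
rewrite /xeval /xcoef !raddf_sum /= [RHS]big_mkcond; apply: eq_bigr => M _.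
rewrite mcoeffZ mcoeffX; case: eqP; rewrite ?(mulr0, mulr1) //.
by rewrite mevalZ mevalX.
Qed.

Lemma meval_xeval G x y : (xeval G x).@[y] = G.@[vjoin x y].
Proof.
rewrite meval_split /xeval raddf_sum; apply: eq_bigr => M _ /=.
by rewrite mevalZ mevalX.
Qed.

Lemma xcoef_eq0 G b : (forall M, M \in msupp G -> mright M != b) -> xcoef G b = 0.
Proof.
by move=> Gb; rewrite /xcoef big_seq_cond big1 // => M /andP[/Gb /negbTE ->].
Qed.

Lemma xcoef_homog G b e :
  (forall M, M \in msupp G -> mright M = b -> mdeg (mleft M) = e) ->
  xcoef G b \is e.-homog.
Proof.
move=> Gb; rewrite /xcoef big_seq_cond; apply: rpred_sum => M /andP[MG /eqP Mb].
by apply: rpredZ; rewrite dhomogX; apply/eqP/Gb.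
Qed.

End Splitting.

Section Homogeneous.
Variable K : fieldType.

Lemma mcoeff_pihomog n (mf : measure n) d (p : {mpoly K[n]}) M :
  (pihomog mf d p)@_M = if mf M == d then p@_M else 0.
Proof.
rewrite pihomogE raddf_sum /=; case: ifPn => Md; last first.
  rewrite big1 // => M' /eqP M'd; rewrite mcoeffZ mcoeffX.
  by case: eqP => [E|]; rewrite ?mulr0 //; rewrite -M'd E eqxx in Md.
rewrite [in RHS](mpolyE p) raddf_sum /= big_mkcond; apply: eq_bigr => M' _.
case: ifPn => // M'd; rewrite mcoeffZ mcoeffX; case: eqP => [E|]; rewrite ?mulr0 //.
by rewrite E Md in M'd.
Qed.

Lemma homog_mdeg n e (G : {mpoly K[n]}) M : G \is e.-homog -> M \in msupp G -> mdeg M = e.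
Proof. by move=> Ge MG; apply: (dhomog_mf Ge MG). Qed.

Lemma meval_homogZ n e (G : {mpoly K[n]}) s x : G \is e.-homog ->
  G.@[fun i => s * x i] = s ^+ e * G.@[x].
Proof.
move=> Ge; rewrite !mevalE mulr_sumr !big_seq; apply: eq_bigr => M /(homog_mdeg Ge) Me.
rewrite mulrCA; congr (_ * _); have -> : e = (\sum_i M i)%N by rewrite -Me; apply: mdegE.
rewrite (eq_bigr (fun i => s ^+ M i * x i ^+ M i)); last by move=> i _; rewrite exprMn.
by rewrite big_split /= prodrXr.
Qed.

Variables (n m e : nat) (G : {mpoly K[n + m]}).
Hypothesis Ge : G \is e.-homog.

Lemma homog_xcoef b : (mdeg b <= e)%N -> xcoef G b \is (e - mdeg b).-homog.
Proof.
move=> be; apply: xcoef_homog => M MG <-.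
by rewrite -(homog_mdeg Ge MG) mdeg_split addnK.
Qed.

Lemma homog_xcoef0 b : (e < mdeg b)%N -> xcoef G b = 0.
Proof.
move=> be; apply: xcoef_eq0 => M MG; apply: contraTneq be => <-.
by rewrite -(homog_mdeg Ge MG) mdeg_split -leqNgt leq_addl.
Qed.

(** In a form, the degree in the first variables is complementary to the degree in the
    last ones. *)
Lemma xevalZ s x : xeval G (fun i => s * x i) =
  \sum_(c < e.+1) s ^+ c *: pihomog mdeg (e - c) (xeval G x).
Proof.
apply/mpolyP => b; rewrite mcoeff_xeval [in RHS]raddf_sum /=.
have [be|be] := leqP (mdeg b) e; last first.
  rewrite homog_xcoef0 // meval0 big1 // => c _.
  by rewrite mcoeffZ mcoeff_pihomog mcoeff_xeval homog_xcoef0 // meval0 if_same mulr0.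
rewrite (meval_homogZ _ _ (homog_xcoef be)) -mcoeff_xeval.
have cb : (e - mdeg b < e.+1)%N by rewrite ltnS leq_subr.
rewrite (bigD1 (Ordinal cb)) //= mcoeffZ mcoeff_pihomog subKn // eqxx.
rewrite big1 ?addr0 // => c; rewrite -val_eqE /= => cE.
rewrite mcoeffZ mcoeff_pihomog ifN ?mulr0 //; apply: contraNneq cE => ->.
by rewrite subKn // -ltnS.
Qed.

End Homogeneous.

(** * Isotropic vectors of systems of forms *)

Section Roots.
Variable K : closedFieldType.

Lemma exists_root (c : K) k : (0 < k)%N -> exists s, s ^+ k = c.
Proof.
move=> k0; have : size ('X^k - c%:P) != 1%N by rewrite size_XnsubC // eqSS -lt0n.
move=> /closed_rootP[s]; rewrite /root !hornerE subr_eq0 => /eqP.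
by exists s.
Qed.

Hypothesis charK0 : [pchar K] =i pred0.

(** If all [k]-th roots of [-1] had the same [e]-th power, every [k]-th root of unity would
    be a root of ['X^(e %% k) - 1], which has fewer than [k] roots. *)
Lemma neg_roots k e : ~~ (k %| e)%N -> (0 < k)%N -> exists eps eps' : K,
  [/\ eps ^+ k = -1, eps' ^+ k = -1 & eps ^+ e != eps' ^+ e].
Proof.
move=> ke k0; have [eps epsE] := exists_root (-1) k0.
suff [z zk ze] : exists2 z : K, z ^+ k = 1 & z ^+ e != 1.
  have e0 : eps != 0.
    by apply: contra_eq_neq epsE => ->; rewrite expr0n eqn0Ngt k0 eq_sym oppr_eq0 oner_eq0.
  exists eps, (eps * z); rewrite !exprMn zk mulr1; split=> //.
  by rewrite -{1}[eps ^+ e]mulr1 (inj_eq (mulfI (expf_neq0 e e0))) eq_sym.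
apply: contrapT => nz.
have H (z : K) : z ^+ k = 1 -> z ^+ (e %% k)%N = 1.
  move=> zk; have : z ^+ e = 1 by apply: contrapT => /eqP ze; apply: nz; exists z.
  by rewrite {1}(divn_eq e k) exprD mulnC exprM zk expr1n mul1r.
set r := (e %% k)%N in H; have r0 : (0 < r)%N by rewrite lt0n.
have [rs] := closed_field_poly_normal ('X^k - 1 : {poly K}).
rewrite lead_coefDl ?lead_coefXn ?scale1r; last first.
  by rewrite size_polyN size_poly1 size_polyXn ltnS.
move=> pE.
have urs : uniq rs.
  rewrite -separable_prod_XsubC -pE separable_Xn_sub_1 //.
  by move/pcharf0P: charK0 => ->; rewrite -lt0n.
have szrs : size rs = k.
  have /(congr1 (size : {poly K} -> nat)) := pE; rewrite size_prod_XsubC -polyC1 size_XnsubC //.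
  by case.
suff : (size rs < size ('X^r - 1%:P : {poly K})%R)%N.
  by rewrite szrs size_XnsubC // ltnS leqNgt ltn_pmod.
apply: max_poly_roots => //.
  by rewrite -size_poly_eq0 size_XnsubC.
apply/allP => z zrs; have : root ('X^k - 1) z by rewrite pE root_prod_XsubC.
rewrite /root !hornerE subr_eq0 => /eqP/H ->.
by rewrite subrr.
Qed.

End Roots.

Section Isotropy.
Variables (K : closedFieldType) (k : nat).
Hypotheses (charK0 : [pchar K] =i pred0) (k_gt0 : (0 < k)%N).

(** The number [n] of variables serves all families of forms of degrees [e]
    depending on a parameter, and the common zero is bounded at the place, so that
    it has a limit. *)
Definition solvable (T : finType) (e : T -> nat) : Prop := exists n,
  forall I (P : place K I) (G : T -> I -> {mpoly K[n]}),
    (forall t i, G t i \is (e t).-homog) ->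
  exists l : 'I_n -> I -> K, (forall j, bounded P (l j)) /\
    large P [set i | (forall t, (G t i).@[fun j => l j i] = 0) /\
                     \sum_j l j i ^+ k = 1].

(** The [l a] span an [m]-dimensional space of common zeros of [G] on which both the
    [k]-th power sum and the further form [g] are diagonal. *)
Definition diagonalizable m (T : finType) (e : T -> nat) D : Prop := exists n,
  forall I (P : place K I) (G : T -> I -> {mpoly K[n]}) (g : I -> {mpoly K[n]}),
    (forall t i, G t i \is (e t).-homog) -> (forall i, g i \is D.-homog) ->
  exists (l : 'I_m -> 'I_n -> I -> K) (al : 'I_m -> I -> K),
    (forall a j, bounded P (l a j)) /\
    large P [set i | forall s : 'I_m -> K,
      let x j := \sum_a s a * l a j i in
      [/\ \sum_j x j ^+ k = \sum_a s a ^+ k, forall t, (G t i).@[x] = 0 &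
          (g i).@[x] = \sum_a al a i * s a ^+ D]].

(** The induction on systems decreases the largest degree [D], then the number [N] of
    forms of that degree. *)
Definition admissible D N (T : finType) (e : T -> nat) :=
  [/\ forall t, ~~ (k %| e t)%N, forall t, (e t <= D)%N & (#|[pred t | e t == D]| <= N)%N].

Lemma admissible_card D N (T T' : finType) (e : T -> nat) (e' : T' -> nat) (h : T' -> option T) :
  (#|[pred t | e t == D]| <= N)%N ->
  (forall z z', e' z = D -> e' z' = D -> h z = h z' -> z = z') ->
  (forall z, e' z = D -> exists2 t, h z = Some t & e t = D) ->
  (#|[pred z | e' z == D]| <= N)%N.
Proof.
move=> cardD hinj hD; apply: leq_trans cardD.
rewrite -(card_image Some_inj [pred t | e t == D]).
have /card_in_image <- : {in [pred z | e' z == D] &, injective h}.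
  by move=> z z'; rewrite !inE => /eqP zD /eqP zD'; apply: hinj.
apply: subset_leq_card; apply/fintype.subsetP => u /mapP[z].
by rewrite mem_enum inE => /eqP/hD[t -> /eqP tD] ->; apply/mapP; exists t; rewrite ?mem_enum ?inE.
Qed.

(** The vectors are found one at a time, in complementary groups of variables. Write a
    form at [s0 l1 + y], with [l1] in the first group and [y] in the second, as a
    polynomial in [s0]. The terms whose degree in [s0] is not divisible by [k] are
    killed by the choice of [l1], which has to solve the system of their
    coefficients with respect to [y]; those whose degree is divisible by [k] have a
    degree in [y] that is not, and are added to the system that the other vectors
    solve. Only the pure powers of [g] survive. *)
Lemma diagonalize D N m : ~~ (k %| D)%N ->
  (forall (T : finType) (e : T -> nat), admissible D N e -> solvable e) ->
  forall (T : finType) (e : T -> nat), admissible D N e -> diagonalizable m e D.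
Proof.
move=> kD sol; elim: m => [|m IH] T e adm.
  exists 0%N => I P G g Gh gh; exists (fun _ _ _ => 0), (fun _ _ => 0); split=> [[]//|].
  have z d (p : {mpoly K[0]}) x : ~~ (k %| d)%N -> p \is d.-homog -> p.@[x] = 0.
    move=> kd pd; rewrite mevalE big_seq big1 // => M /(homog_mdeg pd).
    by rewrite mdegE big_ord0 => d0; rewrite -d0 dvdn0 in kd.
  have [ke _ _] := adm; apply: largeS (largeT P) => i _ s x; split.
  - by rewrite !big_ord0.
  - by move=> t; apply: z (Gh t i).
  - by rewrite big_ord0; apply: z (gh i).
have [ke eD cardD] := adm.
pose e' (u : option T) := if u is Some t then e t else D.
have e'D u : (e' u <= D)%N by case: u => //= t.
have ke' u : ~~ (k %| e' u)%N by case: u.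
(* the conditions on the other vectors: None stands for g, whose component of degree 0
   in the new vector is the form to be diagonalized *)
pose Q2 (z : option T * 'I_D.+1) := [&& (k %| z.2)%N, (z.2 <= e' z.1)%N & z != (None, ord0)].
pose T2 : finType := {z | Q2 z}; pose e2 (z : T2) := (e' (val z).1 - (val z).2)%N.
have z20 z : e2 z = D -> (val z).2 = ord0.
  case/and3P: (valP z) => _ + _; rewrite /e2.
  by case: (val z) => u c /= ze zD; apply: val_inj => /=; have := e'D u; lia.
have adm2 : admissible D N e2.
  split.
  - move=> z; case/and3P: (valP z) => kz ze _; apply: contra (ke' (val z).1) => kez.
    by rewrite -(subnK ze) dvdn_add.
  - by move=> z; apply: leq_trans (leq_subr _ _) (e'D _).
  - apply: (admissible_card (h := fun z : T2 => (val z).1) cardD).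
      move=> z z' /z20 z0 /z20 z'0 zz'; apply: val_inj.
      by rewrite [val z]surjective_pairing [val z']surjective_pairing z0 z'0 zz'.
    move=> z zD; have z0 := z20 z zD; move: zD; rewrite /e2 z0 subn0.
    case E : (val z).1 => [t|]; first by exists t.
    case/and3P: (valP z) => _ _ /eqP[].
    by rewrite [val z]surjective_pairing E z0.
have [n2 diag2] := IH _ _ adm2.
(* the conditions on the new vector; the component of g of full degree in it is left free *)
pose Q1 (z : option T * 'X_{1..n2 < D.+1}) :=
  [&& (mdeg z.2 <= e' z.1)%N, ~~ (k %| e' z.1 - mdeg z.2)%N &
      ~~ ((z.1 == None) && (mdeg z.2 == 0%N))].
pose T1 : finType := {z | Q1 z}; pose e1 (z : T1) := (e' (val z).1 - mdeg (val z).2)%N.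
have z10 z : e1 z = D -> mdeg (val z).2 = 0%N.
  case/and3P: (valP z) => + _ _; rewrite /e1; case: (val z) => u b /= ze zD.
  by have := e'D u; lia.
have [n1 sol1] : solvable e1.
  apply: sol; split.
  - by move=> z; case/and3P: (valP z).
  - by move=> z; apply: leq_trans (leq_subr _ _) (e'D _).
  - apply: (admissible_card (h := fun z : T1 => (val z).1) cardD).
      move=> z z' /z10 z0 /z10 z'0 zz'; apply: val_inj.
      rewrite [val z]surjective_pairing [val z']surjective_pairing zz'; congr (_, _).
      by apply/eqP; rewrite bmeqP; move/eqP: z0; move/eqP: z'0; rewrite !mdeg_eq0 => /eqP -> /eqP ->.
    move=> z zD; have z0 := z10 z zD; move: zD; rewrite /e1 z0 subn0.
    case E : (val z).1 => [t|]; first by exists t.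
    by case/and3P: (valP z) => _ _; rewrite E z0.
exists (n1 + n2)%N => I P G g Gh gh.
pose G' (u : option T) i := if u is Some t then G t i else g i.
have G'h u i : G' u i \is (e' u).-homog by case: u => [t|]; [apply: Gh | apply: gh].
pose G1 (z : T1) i := xcoef (G' (val z).1 i) (val z).2.
have G1h z i : G1 z i \is (e1 z).-homog.
  by apply: homog_xcoef => //; case/and3P: (valP z).
have [l1 [bl1 Pl1]] := sol1 I P G1 G1h.
pose G2i u c i := pihomog mdeg (e' u - c) (xeval (G' u i) (fun j => l1 j i)).
pose G2 (z : T2) i := G2i (val z).1 (val z).2 i.
have [l2 [al2 [bl2 Pl2]]] := diag2 I P G2 (fun i => pihomog mdeg D (xeval (g i) (fun j => l1 j i)))
  (fun z i => pihomogP _ _ _) (fun i => pihomogP _ _ _).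
pose l (a : 'I_m.+1) j i : K := if unlift ord0 a is Some a' then
  vjoin (fun _ => 0) (fun j => l2 a' j i) j else vjoin (fun j => l1 j i) (fun _ => 0) j.
pose al (a : 'I_m.+1) i : K := if unlift ord0 a is Some a' then al2 a' i else
  (xcoef (g i) 0%MM).@[fun j => l1 j i].
exists l, al; split.
  have b0 : bounded P (fun=> 0) by exists 0; apply: tends0.
  move=> a j; rewrite /l /vjoin; case: (unliftP ord0 a) => [a' _|_]; case: (fintype.split j) => j' //.
apply: largeS (largeI Pl1 Pl2) => i /= [[l1G l1k] H2] s.
set x1 := fun j => l1 j i; set s0 := s ord0; pose s' a := s (lift ord0 a).
pose y j := \sum_a s' a * l2 a j i.
set x : 'I_(n1 + n2) -> K := fun j => \sum_a s a * l a j i; have xE : x =1 vjoin (fun j => s0 * x1 j) y.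
  move=> j; rewrite /x big_ord_recl {1}/l unlift_none.
  rewrite (eq_bigr (fun a => s' a * vjoin (fun _ => 0) (fun j => l2 a j i) j)); last first.
    by move=> a _; rewrite /l liftK.
  rewrite -(splitK j); case: (fintype.split j) => j' /=; rewrite ?(vjoinl, vjoinr).
    by rewrite big1 ?addr0 // => a _; rewrite ?(vjoinl, vjoinr) mulr0.
  by rewrite mulr0 add0r; apply: eq_bigr => a _; rewrite ?(vjoinl, vjoinr).
have [yk yG yg] := H2 s'; rewrite -/y in yk yG yg.
have xG u : (G' u i).@[x] = \sum_(c < (e' u).+1) s0 ^+ c * (G2i u c i).@[y].
  rewrite (meval_eq _ xE) -meval_xeval (xevalZ (G'h u i)) raddf_sum /=.
  by apply: eq_bigr => c _; rewrite mevalZ.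
have G2coef u c b : (G2i u c i)@_b =
    if mdeg b == (e' u - c)%N then (xcoef (G' u i) b).@[x1] else 0.
  by rewrite mcoeff_pihomog mcoeff_xeval.
have G2k u c : (c <= e' u)%N -> (k %| c)%N -> (u, c) != (None, 0%N) -> (G2i u c i).@[y] = 0.
  move=> ce kc uc; have cD : (c < D.+1)%N by rewrite ltnS (leq_trans ce).
  have Qc : Q2 (u, Ordinal cD).
    by rewrite /Q2 /= kc ce /=; apply: contraNneq uc => -[-> /= ->].
  exact: (yG (exist (fun z => Q2 z) _ Qc)).
have G2nk u c : (c <= e' u)%N -> ~~ (k %| c)%N ->
    G2i u c i = if (u == None) && (c == D :> nat) then ((xcoef (g i) 0%MM).@[x1])%:MP else 0.
  move=> ce kc; apply/mpolyP => b; rewrite G2coef; case: eqP => [bE|bE]; last first.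
    case: ifP => [/andP[/eqP uN /eqP cE]|]; rewrite ?mcoeff0 // mcoeffC.
    case: eqP => [b0|]; rewrite ?mulr0 //; case: bE.
    by rewrite b0 mdeg0 uN cE subnn.
  have bD : (mdeg b < D.+1)%N by rewrite ltnS bE; apply: leq_trans (leq_subr _ _) (e'D u).
  have [/andP[/eqP uN b0]|Qb] := boolP ((u == None) && (mdeg b == 0%N)).
    move: b0; rewrite uN eqxx mdeg_eq0 /= => /eqP b0; move: ce bE; rewrite uN b0 mdeg0 /= => ce bE.
    have -> : c == D :> nat by apply/eqP; lia.
    by rewrite mcoeffC eqxx mulr1.
  have Q1b : Q1 (u, BMultinom bD) by rewrite /Q1 /= Qb andbT bE leq_subr subKn.
  have -> : (xcoef (G' u i) b).@[x1] = 0 by apply: (l1G (exist (fun z => Q1 z) _ Q1b)).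
  case: ifP => [/andP[uN /eqP cE]|]; rewrite ?mcoeff0 // mcoeffC; case: eqP => b0; rewrite ?mulr0 //.
  by rewrite uN b0 mdeg0 in Qb.
have D0 : (0 < D)%N by rewrite lt0n; apply: contraNneq kD => ->; apply: dvdn0.
split.
- rewrite (eq_bigr (fun j => vjoin (fun j => s0 * x1 j) y j ^+ k)); last first.
    by move=> j _; congr (_ ^+ k); exact: xE.
  rewrite big_split_ord [in RHS]big_ord_recl; congr (_ + _).
    rewrite (eq_bigr (fun j => s0 ^+ k * x1 j ^+ k)); last by move=> j _; rewrite vjoinl exprMn.
    by rewrite -mulr_sumr l1k mulr1.
  by rewrite -yk; apply: eq_bigr => j _; rewrite vjoinr.
- move=> t; rewrite [LHS](xG (Some t)) big1 // => c _.
  have ce : (c <= e' (Some t))%N by rewrite -ltnS.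
  have [kc|/(G2nk _ _ ce) ->] := boolP (k %| c)%N; first by rewrite G2k // mulr0.
  by rewrite meval0 mulr0.
rewrite [LHS](xG None) [LHS]big_ord_recl [RHS]big_ord_recl {1}/al unlift_none [LHS]addrC; congr (_ + _).
  have lastD : (D.-1 < D)%N by rewrite ltn_predL.
  have lift_lt (c : 'I_D) : (lift ord0 c <= D)%N by rewrite lift0.
  have bD : bump 0 D.-1 = D by rewrite /bump leq0n add1n prednK.
  rewrite (bigD1 (Ordinal lastD)) //= bD (G2nk None D) // !eqxx mevalC.
  rewrite big1 ?addr0 1?mulrC // => c cD.
  have [kc|kc] := boolP (k %| lift ord0 c)%N; first by rewrite (G2k None) ?mulr0 ?lift0.
  rewrite (G2nk None) //; case: ifP => [/andP[_ /eqP cE]|_]; last by rewrite meval0 mulr0.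
  by case/eqP: cD; apply: val_inj => /=; rewrite /= /bump leq0n in cE; lia.
rewrite expr0 mul1r /G2i subn0 yg; apply: eq_bigr => a _.
by rewrite /al liftK.
Qed.

(** The points [(s, s * eta, 1)] with [eta ^+ k = -1] have [k]-th power sum [1], and the
    diagonal form takes the value [s ^+ D * ga eta + a2] there, [ga] being as in the proof.
    For two choices of [eta] with distinct [D]-th powers, [a1] is a combination of
    the two values of [ga], hence a multiple of one of them by divisibility; so is
    [a2], and [s] is a [D]-th root of the opposite of the quotient. *)
Lemma divides_isotropic I (P : place K I) D (a0 a1 a2 : I -> K) : ~~ (k %| D)%N ->
  (exists2 c, bounded P c & large P [set i | a2 i = c i * a1 i]) ->
  exists (eta : K) (s : I -> K), [/\ eta ^+ k = -1, bounded P s &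
    large P [set i | a0 i * s i ^+ D + a1 i * (s i * eta) ^+ D + a2 i = 0]].
Proof.
move=> kD [c bc a21]; have [eps [eps' [ek ek' eD]]] := neg_roots charK0 kD k_gt0.
have bM f g : bounded P f -> bounded P g -> bounded P (f * g).
  by move=> [x Px] [y Py]; exists (x * y); apply: tends_mul.
have bC x : bounded P (fun=> x) by exists x; apply: tends_cst.
have bB f g : bounded P f -> bounded P g -> bounded P (f - g).
  by move=> [x Px] [y Py]; exists (x - y); apply: tends_sub.
pose ga (x : K) i := a0 i + x ^+ D * a1 i.
suff [eta etak [c1 bc1 a1g]] : exists2 eta, eta ^+ k = -1 & exists2 c1, bounded P c1 &
    large P [set i | a1 i = c1 i * ga eta i].
  have D0 : (0 < D)%N by rewrite lt0n; apply: contraNneq kD => ->; apply: dvdn0.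
  have [s sE] : exists s : I -> K, forall i, s i ^+ D = - (c i * c1 i).
    have [s sE] := choice (fun i => exists_root (- (c i * c1 i)) D0).
    by exists s.
  exists eta, s; split=> //.
    apply: (bounded_root D0); rewrite (_ : s ^+ D = (fun=> -1) * (c * c1)).
      by apply: (bM _ _ (bC _)); apply: (bM).
    apply: funext => i; rewrite -[RHS]/(-1 * (c i * c1 i)) mulN1r -sE.
    by elim: (D) => // d IH; rewrite !exprS -IH.
  apply: largeS (largeI a21 a1g) => i /= [-> a1E].
  have -> : a0 i * s i ^+ D + a1 i * (s i * eta) ^+ D = s i ^+ D * ga eta i.
    by rewrite exprMn /ga; ring.
  by rewrite sE a1E mulNr mulrA addNr.
pose kap := (eps ^+ D - eps' ^+ D)^-1.
have a1E i : a1 i = kap * (ga eps i - ga eps' i).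
  have -> : ga eps i - ga eps' i = (eps ^+ D - eps' ^+ D) * a1 i by rewrite /ga; ring.
  by rewrite /kap mulKf // subr_eq0.
have [c1 bc1 [gg|gg]] := bounded_dich P (ga eps) (ga eps').
  exists eps => //; exists ((fun=> kap) * (1 - c1)); first by apply/bM/bB => //; apply: bC.
  apply: largeS gg => i /= gi; rewrite -[(_ * _) i]/(kap * (1 - c1 i)).
  by rewrite a1E gi; ring.
exists eps' => //; exists ((fun=> kap) * (c1 - 1)); first by apply/bM/bB => //; apply: bC.
apply: largeS gg => i /= gi; rewrite -[(_ * _) i]/(kap * (c1 i - 1)).
by rewrite a1E gi; ring.
Qed.

(** The extra form [G t0] of degree [D] is made diagonal on a space of dimension three
    where the other forms vanish; divisibility orders its last two coefficients. *)
Lemma solvable_add_form D N : ~~ (k %| D)%N ->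
  (forall (T : finType) (e : T -> nat), admissible D N e -> solvable e) ->
  forall (T : finType) (e : T -> nat), admissible D N.+1 e -> solvable e.
Proof.
move=> kD sol T e [ke eD cardD].
have [t0 t0D|noD] := pickP [pred t | e t == D]; last first.
  by apply: sol; split=> //; rewrite eq_card0.
pose T' : finType := {t | t != t0}; pose e' (t : T') := e (val t).
have adm' : admissible D N e'.
  split=> [t|t|]; [exact: ke | exact: eD |].
  move: cardD; rewrite (cardD1 t0) inE [e t0 == D]t0D add1n ltnS; apply: leq_trans.
  rewrite -(card_image val_inj); apply: subset_leq_card; apply/fintype.subsetP => u /mapP[t].
  by rewrite mem_enum !inE => tD ->; rewrite (valP t).
have [n diag] := @diagonalize D N 3 kD sol _ _ adm'.
exists n => I P G Gh.
have [l [al [bl Pl]]] := diag I P (fun t => G (val t)) (G t0) (fun t => Gh (val t))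
  (fun i => eq_ind (e t0) (fun d => is_true (G t0 i \is d.-homog)) (Gh t0 i) D (eqP t0D)).
pose o1 : 'I_3 := @Ordinal 3 1 isT; pose o2 : 'I_3 := @Ordinal 3 2 isT.
have [b [c [cE eq3 [db dc]]]] : exists b c : 'I_3,
    [/\ exists2 q, bounded P q & large P [set i | al c i = q i * al b i],
        forall F : 'I_3 -> K, \sum_a F a = F ord0 + F b + F c &
        b != ord0 /\ (c != ord0 /\ b != c)].
  have [q bq []] := bounded_dich P (al o1) (al o2).
    exists o1, o2; split=> //; first by exists q.
    by move=> F; rewrite !big_ord_recl big_ord0 addr0 addrA; congr (_ + F _ + F _); apply: val_inj.
  exists o2, o1; split=> //; first by exists q.
  move=> F; rewrite !big_ord_recl big_ord0 addr0 -addrA [F o2 + _]addrC.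
  by congr (_ + (F _ + F _)); apply: val_inj.
have [eta [s [etak bs Ps]]] := @divides_isotropic _ _ _ (al ord0) _ _ kD cE.
pose S (a : 'I_3) i := if a == ord0 then s i else if a == b then s i * eta else 1.
have S0 i : S ord0 i = s i by [].
have Sb i : S b i = s i * eta by rewrite /S (negbTE db) eqxx.
have Sc i : S c i = 1 by rewrite /S (negbTE dc.1) eq_sym (negbTE dc.2).
exists (fun j i => \sum_a S a i * l a j i); split.
  move=> j; have bD f g : bounded P f -> bounded P g -> bounded P (f + g).
    by move=> [x Px] [y Py]; exists (x + y); apply: tends_add.
  have bM f g : bounded P f -> bounded P g -> bounded P (f * g).
    by move=> [x Px] [y Py]; exists (x * y); apply: tends_mul.
  have bC x : bounded P (fun=> x) by exists x; apply: tends_cst.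
  rewrite (_ : (fun i => _) = s * l ord0 j + (s * (fun=> eta)) * l b j + l c j).
    by apply/bD/bl/bD; apply: (bM _ _ _ (bl _ _)) => //; apply: (bM).
  by apply: funext => i; rewrite eq3 S0 Sb Sc mul1r.
apply: largeS (largeI Pl Ps) => i /= [H Hs]; have [Hk HG Hg] := H (fun a => S a i).
split=> [t|]; last by rewrite Hk eq3 S0 Sb Sc exprMn etak mulrN1 expr1n subrr add0r.
have [->|tt0] := eqVneq t t0; last exact: (HG (exist (fun t => is_true (t != t0)) _ tt0)).
by rewrite Hg eq3 S0 Sb Sc expr1n mulr1.
Qed.

Theorem isotropic_system (T : finType) (e : T -> nat) :
  (forall t, ~~ (k %| e t)%N) -> solvable e.
Proof.
move=> ke; pose D := (\max_t e t)%N.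
have : forall t, (e t <= D)%N by move=> t; apply: leq_bigmax.
move: D => D; elim: D T e ke => [|D IH] T e ke eD.
  exists 1%N => I P G _; exists (fun _ _ => 1); split; first by exists 1; apply: tends1.
  apply: largeS (largeT P) => i _ /=; split; last by rewrite big_ord1 expr1n.
  by move=> t; case/negP: (ke t); have := eD t; rewrite leqn0 => /eqP ->; apply: dvdn0.
have [kD|kD] := boolP (k %| D.+1)%N.
  apply: IH => // t; have := eD t; rewrite leq_eqVlt ltnS => /predU1P[tD|//].
  by case/negP: (ke t); rewrite tD.
suff sol N : forall (T : finType) (e : T -> nat), admissible D.+1 N e -> solvable e.
  by apply: (sol #|T|); split=> //; apply: max_card.
elim: N => [|N IHN]; last exact: solvable_add_form.
move=> {T e ke eD} T e [ke eD]; rewrite leqn0 => /eqP/card0_eq no; apply: IH => // t.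
by have := eD t; rewrite leq_eqVlt ltnS; have := no t; rewrite inE => ->.
Qed.

End Isotropy.

(** * Polynomial functions, polynomial maps and Zariski closures *)

Section PolynomialFun.
Variables (K : fieldType) (W : lmodType K).
Implicit Types (f g : W -> K) (X : set W).

Lemma polynomial_fun_pair f g : polynomial_fun f -> polynomial_fun g ->
  exists k (l : 'I_k -> {scalar W}) (p q : {mpoly K[k]}),
    (forall w, f w = p.@[fun i => l i w]) /\ (forall w, g w = q.@[fun i => l i w]).
Proof.
move=> [k1 [l1 [p fE]]] [k2 [l2 [q gE]]].
exists (k1 + k2)%N, (vjoin l1 l2).
exists (p \mPo [tuple 'X_(lshift k2 i) | i < k1]), (q \mPo [tuple 'X_(rshift k1 i) | i < k2]).
split=> w; [rewrite fE | rewrite gE]; rewrite comp_mpoly_meval; apply: meval_eq => i;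
  by rewrite tnth_mktuple mevalXU ?vjoinl ?vjoinr.
Qed.

Lemma polynomial_fun_cst c : polynomial_fun (fun _ : W => c).
Proof.
have l : 'I_0 -> {scalar W} by case.
by exists 0%N, l, c%:MP => w; rewrite mevalC.
Qed.

Lemma polynomial_fun_scalar (l : {scalar W}) : polynomial_fun l.
Proof. by exists 1%N, (fun _ => l), 'X_ord0 => w; rewrite mevalXU. Qed.

Lemma polynomial_fun_add f g : polynomial_fun f -> polynomial_fun g ->
  polynomial_fun (fun w => f w + g w).
Proof.
move=> /polynomial_fun_pair/[apply] -[k [l [p [q [fE gE]]]]].
by exists k, l, (p + q) => w; rewrite mevalD fE gE.
Qed.

Lemma polynomial_fun_mul f g : polynomial_fun f -> polynomial_fun g ->
  polynomial_fun (fun w => f w * g w).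
Proof.
move=> /polynomial_fun_pair/[apply] -[k [l [p [q [fE gE]]]]].
by exists k, l, (p * q) => w; rewrite mevalM fE gE.
Qed.

Lemma polynomial_fun_sum (J : Type) (s : seq J) (Q : pred J) (F : J -> W -> K) :
  (forall j, Q j -> polynomial_fun (F j)) -> polynomial_fun (fun w => \sum_(j <- s | Q j) F j w).
Proof.
move=> QF; elim: s => [|j s IH].
  rewrite (_ : (fun w => _) = fun=> 0); first exact: polynomial_fun_cst.
  by apply: funext => w; rewrite big_nil.
have [Qj|Qj] := boolP (Q j).
  rewrite (_ : (fun w => _) = fun w => F j w + \sum_(j <- s | Q j) F j w).
    by apply: polynomial_fun_add IH; apply: QF.
  by apply: funext => w; rewrite big_cons Qj.
by rewrite (_ : (fun w => _) = fun w => \sum_(j <- s | Q j) F j w) //;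
  apply: funext => w; rewrite big_cons (negbTE Qj).
Qed.

Lemma polynomial_fun_prod (J : Type) (s : seq J) (F : J -> W -> K) :
  (forall j, polynomial_fun (F j)) -> polynomial_fun (fun w => \prod_(j <- s) F j w).
Proof.
move=> QF; elim: s => [|j s IH].
  rewrite (_ : (fun w => _) = fun=> 1); first exact: polynomial_fun_cst.
  by apply: funext => w; rewrite big_nil.
rewrite (_ : (fun w => _) = fun w => F j w * \prod_(j <- s) F j w).
  exact: polynomial_fun_mul.
by apply: funext => w; rewrite big_cons.
Qed.

Lemma polynomial_fun_exp f n : polynomial_fun f -> polynomial_fun (fun w => f w ^+ n).
Proof.
move=> pf; elim: n => [|n IH]; first exact: polynomial_fun_cst.
rewrite (_ : (fun w => _) = fun w => f w * f w ^+ n); first exact: polynomial_fun_mul.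
by apply: funext => w; rewrite exprS.
Qed.

Lemma polynomial_fun_meval k (p : {mpoly K[k]}) (F : 'I_k -> W -> K) :
  (forall j, polynomial_fun (F j)) -> polynomial_fun (fun w => p.@[fun j => F j w]).
Proof.
move=> pF; rewrite (_ : (fun w => _) = fun w =>
    \sum_(m <- msupp p) p@_m * \prod_i F i w ^+ m i).
  apply: polynomial_fun_sum => m _; apply: polynomial_fun_mul; first exact: polynomial_fun_cst.
  by apply: polynomial_fun_prod => i; apply: polynomial_fun_exp.
by apply: funext => w; rewrite mevalE.
Qed.

Lemma zariski_closureP X (v : W) : zariski_closure X v <->
  (forall E : W -> K, polynomial_fun E -> (forall x, X x -> E x = 0) -> E v = 0).
Proof.
split=> [Xf E pE XE|H Z [F [pF ->]] XZ]; last first.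
  by move=> E FE; apply: H; [exact: pF | move=> x /XZ; apply].
apply: (Xf [set x | E x = 0]) => //; exists [set E]; split; first by move=> _ ->.
by apply/seteqP; split=> x /=; [move=> Ex _ -> | apply].
Qed.

Lemma subset_zariski_closure X : X `<=` zariski_closure X.
Proof. by move=> x Xx; apply/zariski_closureP => E _; apply. Qed.

Lemma zariski_closed_closure X : zariski_closed (zariski_closure X).
Proof.
exists [set E | polynomial_fun E /\ forall x, X x -> E x = 0]; split; first by move=> E [].
apply/seteqP; split=> x /=; first by move=> /zariski_closureP H E [] /H; apply.
by move=> H; apply/zariski_closureP => E pE XE; apply: H.
Qed.

End PolynomialFun.

Section PolynomialMap.
Variable K : fieldType.

(** Maps into a possibly infinite-dimensional space whose values are combinations
    of finitely many fixed vectors with polynomial coefficients. *)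
Inductive polynomial_map (W V : lmodType K) : (W -> V) -> Prop :=
| PolynomialMapTerm f v : polynomial_fun f -> polynomial_map (fun w => f w *: v)
| PolynomialMapAdd Phi Psi : polynomial_map Phi -> polynomial_map Psi ->
    polynomial_map (fun w => Phi w + Psi w).

Lemma polynomial_map_cst (W V : lmodType K) (v : V) : polynomial_map (fun _ : W => v).
Proof.
rewrite (_ : (fun=> v) = fun _ : W => 1 *: v).
  exact/PolynomialMapTerm/polynomial_fun_cst.
by apply: funext => w; rewrite scale1r.
Qed.

Lemma polynomial_map_sum (W V : lmodType K) (J : Type) (s : seq J) (Q : pred J)
    (F : J -> W -> V) :
  (forall j, Q j -> polynomial_map (F j)) -> polynomial_map (fun w => \sum_(j <- s | Q j) F j w).
Proof.
move=> QF; elim: s => [|j s IH].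
  rewrite (_ : (fun w => _) = fun=> 0); first exact: polynomial_map_cst.
  by apply: funext => w; rewrite big_nil.
have [Qj|Qj] := boolP (Q j).
  rewrite (_ : (fun w => _) = fun w => F j w + \sum_(j <- s | Q j) F j w).
    by apply: PolynomialMapAdd IH; apply: QF.
  by apply: funext => w; rewrite big_cons Qj.
by rewrite (_ : (fun w => _) = fun w => \sum_(j <- s | Q j) F j w) //;
  apply: funext => w; rewrite big_cons (negbTE Qj).
Qed.

Lemma polynomial_map_mul (W : lmodType K) (V : algType K) (Phi Psi : W -> V) :
  polynomial_map Phi -> polynomial_map Psi -> polynomial_map (fun w => Phi w * Psi w).
Proof.
move=> pPhi; elim: pPhi Psi => {Phi} [f v pf|Phi1 Phi2 _ IH1 _ IH2] Psi pPsi; last first.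
  rewrite (_ : (fun w => _) = fun w => Phi1 w * Psi w + Phi2 w * Psi w).
    by apply: PolynomialMapAdd; [exact: IH1 | exact: IH2].
  by apply: funext => w; rewrite mulrDl.
elim: pPsi => {Psi} [g v' pg|Psi1 Psi2 _ IH1 _ IH2]; last first.
  rewrite (_ : (fun w => _) = fun w => f w *: v * Psi1 w + f w *: v * Psi2 w).
    exact: PolynomialMapAdd.
  by apply: funext => w; rewrite mulrDr.
rewrite (_ : (fun w => _) = fun w => (f w * g w) *: (v * v')).
  exact/PolynomialMapTerm/polynomial_fun_mul.
by apply: funext => w; rewrite -scalerAl -scalerAr scalerA.
Qed.

Lemma polynomial_map_comp_mpoly (W : lmodType K) k n (Psi : W -> {mpoly K[k]})
    (U : 'I_k -> W -> {mpoly K[n]}) :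
  polynomial_map Psi -> (forall j, polynomial_map (U j)) ->
  polynomial_map (fun w => Psi w \mPo [tuple U j w | j < k]).
Proof.
move=> pPsi pU.
have pX m : polynomial_map (fun w => 'X_[m] \mPo [tuple U j w | j < k]).
  rewrite (_ : (fun w => _) = fun w => \prod_(j < k) U j w ^+ m j); last first.
    apply: funext => w; rewrite comp_mpolyX; apply: eq_bigr => j _.
    by rewrite tnth_mktuple.
  elim: (index_enum _) => [|j s IH].
    rewrite (_ : (fun w => _) = fun=> 1); first exact: polynomial_map_cst.
    by apply: funext => w; rewrite big_nil.
  rewrite (_ : (fun w => _) = fun w => U j w ^+ m j * \prod_(j <- s) U j w ^+ m j).
    apply: polynomial_map_mul IH; elim: (m j) => [|a IHa]; first exact: polynomial_map_cst.
    rewrite (_ : (fun w => _) = fun w => U j w * U j w ^+ a); first exact: polynomial_map_mul.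
    by apply: funext => w; rewrite exprS.
  by apply: funext => w; rewrite big_cons.
elim: pPsi => {Psi} [f v pf|Psi1 Psi2 _ IH1 _ IH2]; last first.
  rewrite (_ : (fun w => _) = fun w => (Psi1 w \mPo [tuple U j w | j < k]) +
     (Psi2 w \mPo [tuple U j w | j < k])); first exact: PolynomialMapAdd.
  by apply: funext => w; rewrite comp_mpolyD.
rewrite (_ : (fun w => _) = fun w => \sum_(m <- msupp v)
    (f w * v@_m)%:A * ('X_[m] \mPo [tuple U j w | j < k])).
  apply: polynomial_map_sum => m _; apply: polynomial_map_mul => //.
  by apply/PolynomialMapTerm/polynomial_fun_mul/polynomial_fun_cst.
apply: funext => w; rewrite {1}(mpolyE v) scaler_sumr raddf_sum; apply: eq_bigr => m _ /=.
by rewrite scalerA comp_mpolyZ mulr_algl.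
Qed.

Lemma polynomial_map_linear (W V V' : lmodType K) (L : {linear V -> V'}) (Phi : W -> V) :
  polynomial_map Phi -> polynomial_map (fun w => L (Phi w)).
Proof.
elim=> {Phi} [f v pf|Phi Psi _ IH1 _ IH2].
  rewrite (_ : (fun w => _) = fun w => f w *: L v); first exact: PolynomialMapTerm.
  by apply: funext => w; rewrite linearZ.
rewrite (_ : (fun w => _) = fun w => L (Phi w) + L (Psi w)); first exact: PolynomialMapAdd.
by apply: funext => w; rewrite linearD.
Qed.

Lemma polynomial_fun_comp (W V : lmodType K) (g : V -> K) (Phi : W -> V) :
  polynomial_fun g -> polynomial_map Phi -> polynomial_fun (fun w => g (Phi w)).
Proof.
case=> k [l [p gE]] pPhi.
rewrite (_ : (fun w => _) = fun w => p.@[fun j => l j (Phi w)]); last first.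
  by apply: funext => w; rewrite gE.
apply: polynomial_fun_meval => j; elim: pPhi => {Phi} [f v pf|Phi Psi _ IH1 _ IH2].
  rewrite (_ : (fun w => _) = fun w => f w * l j v).
    exact/polynomial_fun_mul/polynomial_fun_cst.
  by apply: funext => w; rewrite linearZ.
rewrite (_ : (fun w => _) = fun w => l j (Phi w) + l j (Psi w)).
  exact: polynomial_fun_add.
by apply: funext => w; rewrite linearD.
Qed.

Lemma polynomial_fun_comp_linear (W V : lmodType K) (g : V -> K) (L : {linear W -> V}) :
  polynomial_fun g -> polynomial_fun (g \o L).
Proof.
case=> k [l [p gE]]; exists k, (fun j => (l j \o L : {scalar W})), p => w.
by rewrite /= gE.
Qed.

Lemma zariski_closure_linear (W V : lmodType K) (L : {linear W -> V}) (X : set W) (Y : set V) :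
  (forall x, X x -> Y (L x)) -> forall x, zariski_closure X x -> zariski_closure Y (L x).
Proof.
move=> XY x /zariski_closureP Xx; apply/zariski_closureP => E pE YE.
apply: (Xx (E \o L)); first exact: polynomial_fun_comp_linear.
by move=> x' Xx'; apply/YE/XY.
Qed.

Lemma tends_polynomial_fun (V : lmodType K) I (P : place K I) (E : V -> K) (J : finType)
    (b : J -> V) (a : J -> I -> K) (c : J -> K) : polynomial_fun E ->
  (forall j, P (a j) (c j)) ->
  P (fun i => E (\sum_j a j i *: b j)) (E (\sum_j c j *: b j)).
Proof.
case=> k [l [p gE]] Pac; rewrite gE (_ : (fun i => _) = fun i =>
    p.@[fun t => \sum_j a j i * l t (b j)]); last first.
  apply: funext => i; rewrite gE; apply: meval_eq => t.
  by rewrite linear_sum; apply: eq_bigr => j _; rewrite linearZ.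
rewrite (@meval_eq _ _ _ (fun t => \sum_j c j * l t (b j))); last first.
  by move=> t; rewrite linear_sum; apply: eq_bigr => j _; rewrite linearZ.
apply: tends_meval => t; apply: tends_sum => j _.
exact: tends_mul (Pac j) (tends_cst P _).
Qed.

End PolynomialMap.

(** * Weighted forms of bounded strength *)

Section WeightedDegree.

Definition wdeg (w : nat -> nat) n (m : 'X_{1..n}) : nat := (\sum_(i < n) m i * w i)%N.

Fact wdeg0 w n : wdeg w (0%MM : 'X_{1..n}) = 0%N.
Proof. by rewrite /wdeg big1 // => i _; rewrite mnm0E. Qed.

Fact wdegD w n : {morph @wdeg w n : m1 m2 / (m1 + m2)%MM >-> (m1 + m2)%N}.
Proof.
move=> m1 m2; rewrite /wdeg -big_split; apply: eq_bigr => i _.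
by rewrite mnmDE mulnDl.
Qed.

HB.instance Definition _ w n := isMeasure.Build n (@wdeg w n) (wdeg0 w n) (@wdegD w n).

Lemma wdeg1 n (m : 'X_{1..n}) : wdeg (fun=> 1%N) m = mdeg m.
Proof. by rewrite mdegE; apply: eq_bigr => i _; rewrite muln1. Qed.

Lemma mdeg_wdeg w n (m : 'X_{1..n}) : (forall i, (i < n)%N -> (0 < w i)%N) -> (mdeg m <= wdeg w m)%N.
Proof. by move=> w0; rewrite mdegE; apply: leq_sum => i _; rewrite leq_pmulr // w0. Qed.

Variable K : fieldType.

Lemma wdeg1_homog n e (p : {mpoly K[n]}) :
  (p \is e.-homog for (@wdeg (fun=> 1%N) n)) = (p \is e.-homog).
Proof.
by apply/dhomogP/dhomogP => H m /H => [<-|<-]; [exact/esym/wdeg1 | exact: wdeg1].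
Qed.

Lemma wdeg_homog w n e (p : {mpoly K[n]}) m :
  p \is e.-homog for (@wdeg w n) -> m \in msupp p -> wdeg w m = e.
Proof. by move=> pe mp; apply: (dhomog_mf pe mp). Qed.

Lemma homog_bigprod n (mf : measure n) k (F : 'I_k -> {mpoly K[n]}) (a : 'I_k -> nat) :
  (forall j, F j \is (a j).-homog for mf) ->
  \prod_j F j \is (\sum_j a j)%N.-homog for mf.
Proof.
move=> Fa; apply: (big_rec2 (fun p b => p \is b.-homog for mf)); first exact: dhomog1.
by move=> j b p _; apply/dhomogM/Fa.
Qed.

Lemma comp_homog w p n (mf : measure n) e (P : {mpoly K[p]}) (U : 'I_p -> {mpoly K[n]}) :
  P \is e.-homog for (@wdeg w p) -> (forall j, U j \is (w j).-homog for mf) ->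
  P \mPo [tuple U j | j < p] \is e.-homog for mf.
Proof.
move=> Pe Uw; rewrite comp_mpolyEX big_seq; apply: rpred_sum => m mP.
apply: rpredZ; rewrite comp_mpolyX -(wdeg_homog Pe mP); apply: homog_bigprod => j.
by rewrite tnth_mktuple mulnC; apply: dhomogMn.
Qed.

End WeightedDegree.

Section Strength.
Variables (K : fieldType) (d r : nat) (e : 'I_r -> nat).
Implicit Types (w : nat -> nat).

Definition wstrength (w : nat -> nat) p : set {mpoly K[p]} :=
  [set F | exists g h : 'I_r -> {mpoly K[p]},
     [/\ forall i, g i \is (e i).-homog for (@wdeg w p),
         forall i, h i \is (d - e i).-homog for (@wdeg w p) &
         F = \sum_i g i * h i]].

Definition wborder w p : set {mpoly K[p]} := zariski_closure (@wstrength w p).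

Lemma wstrength_comp w p w' n (P : {mpoly K[p]}) (U : 'I_p -> {mpoly K[n]}) :
  (forall j, U j \is (w j).-homog for (@wdeg w' n)) ->
  @wstrength w p P -> @wstrength w' n (P \mPo [tuple U j | j < p]).
Proof.
move=> Uw [g [h [gh hh ->]]].
exists (fun i => g i \mPo [tuple U j | j < p]), (fun i => h i \mPo [tuple U j | j < p]).
split=> [i|i|]; [exact: comp_homog (gh i) Uw | exact: comp_homog (hh i) Uw |].
by rewrite raddf_sum /=; apply: eq_bigr => i _; rewrite rmorphM.
Qed.

Lemma wborder_comp w p w' n (P : {mpoly K[p]}) (U : 'I_p -> {mpoly K[n]}) :
  (forall j, U j \is (w j).-homog for (@wdeg w' n)) ->
  @wborder w p P -> @wborder w' n (P \mPo [tuple U j | j < p]).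
Proof.
move=> Uw; apply: (zariski_closure_linear (L := comp_mpoly [tuple U j | j < p])).
by move=> x; apply: wstrength_comp.
Qed.

Hypothesis e_bnd : forall i, (1 <= e i <= d - 1)%N.

Lemma wstrength_homog w p F : @wstrength w p F -> F \is d.-homog for (@wdeg w p).
Proof.
case=> g [h [gh hh ->]]; apply: rpred_sum => i _.
by rewrite -(subnKC (_ : e i <= d)%N); [exact: dhomogM | have := e_bnd i; lia].
Qed.

Lemma wborder_homog w p F : @wborder w p F -> F \is d.-homog for (@wdeg w p).
Proof.
move=> /zariski_closureP XF; apply/dhomogP => m; rewrite mcoeff_msupp => /eqP Fm.
apply: contrapT => md; apply: Fm; apply: XF; first exact: polynomial_fun_scalar.
by move=> G /wstrength_homog Gd; apply: (dhomog_nemf_coeff Gd); apply/eqP.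
Qed.

Lemma wborder_mdeg w p F m : (forall i, (i < p)%N -> (0 < w i)%N) -> @wborder w p F ->
  (d < mdeg m)%N -> F@_m = 0.
Proof.
move=> w0 /wborder_homog Fd dm; apply: (dhomog_nemf_coeff Fd).
by apply: contraTneq dm => /= <-; rewrite -leqNgt mdeg_wdeg.
Qed.

Section StrengthPlace.
Variables (w : nat -> nat) (p : nat).

(** Arbitrary polynomials, projected to the required degrees: the parameters of a form of
    bounded strength become a set, on which functions and their places make sense. *)
Definition strength_param := (('I_r -> {mpoly K[p]}) * ('I_r -> {mpoly K[p]}))%type.

Definition lfactor (x : strength_param) i := pihomog (@wdeg w p) (e i) (x.1 i).
Definition rfactor (x : strength_param) i := pihomog (@wdeg w p) (d - e i) (x.2 i).
Definition strength_val (x : strength_param) := \sum_i lfactor x i * rfactor x i.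

End StrengthPlace.
End Strength.

(** Restricting polynomial functions to the forms of bounded strength and evaluating them at
    a point of the closure are compatible, so the pairs of both results define a
    partial place. Its extension exhibits the point as a limit. *)
Lemma border_place (K : closedFieldType) d r (e : 'I_r -> nat) w p (F : {mpoly K[p]}) :
  wborder d e w F -> exists P : place K (strength_param K r p),
    forall m, P (fun x => (strength_val d e w x)@_m) F@_m.
Proof.
move=> FX; pose mu := @strength_val K d r e w p.
have muX G : wstrength d e w G -> exists x, G = mu x.
  case=> g [h [gh hh ->]]; exists (g, h); apply: eq_bigr => i _.
  by rewrite /lfactor /rfactor !pihomog_dE.
pose G0 : set (fpair K (strength_param K r p)) :=
  [set ac | exists E : {mpoly K[p]} -> K, [/\ polynomial_fun E, ac.1 = E \o mu & ac.2 = E F]].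
have [|P PG] := @place_extension K _ G0; last first.
  exists P => m; apply: PG; exists (mcoeff m); split=> //.
  exact: polynomial_fun_scalar.
split.
- by move=> c; exists (fun=> c); split=> //; apply: polynomial_fun_cst.
- move=> [a c] [b c'] [E [pE /= -> ->]] [E' [pE' /= -> ->]].
  by exists (fun G => E G + E' G); split=> //; apply: polynomial_fun_add.
- move=> [a c] [b c'] [E [pE /= -> ->]] [E' [pE' /= -> ->]].
  by exists (fun G => E G * E' G); split=> //; apply: polynomial_fun_mul.
- move=> c [E [pE /= E0 ->]]; move/zariski_closureP: FX; apply=> // G /muX[x ->].
  by have := congr1 (fun f => f x) E0.
Qed.

(** * Detecting weights by power sums *)

Lemma comp_mpoly_comp (K : fieldType) n p q (P : {mpoly K[p]}) (U : 'I_p -> {mpoly K[n]})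
    (t : n.-tuple {mpoly K[q]}) :
  (P \mPo [tuple U j | j < p]) \mPo t = P \mPo [tuple U j \mPo t | j < p].
Proof.
rewrite !(comp_mpolyEX P) raddf_sum; apply: eq_bigr => m _ /=.
rewrite comp_mpolyZ !comp_mpolyX rmorph_prod; congr (_ *: _); apply: eq_bigr => j _ /=.
by rewrite !tnth_mktuple rmorphXn.
Qed.

Lemma comp_mpolyM (K : fieldType) n k (t : n.-tuple {mpoly K[k]}) p q :
  (p * q) \mPo t = (p \mPo t) * (q \mPo t).
Proof. exact: rmorphM. Qed.

Lemma msize_leP (K : fieldType) n (p : {mpoly K[n]}) b :
  (forall m, m \in msupp p -> (mdeg m < b)%N) -> (msize p <= b)%N.
Proof. by move=> pb; rewrite msizeE; apply/bigmax_leqP_seq => m /pb. Qed.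

Section OneVariable.
Variables (K : closedFieldType) (m : nat) (w : nat -> nat).
Local Notation k := (w 0).
Local Notation wy := (fun i => w i.+1).
Hypothesis k_gt0 : (0 < k)%N.
Hypothesis wy_gt0 : forall i, (i < m)%N -> (0 < w i.+1)%N.

Definition joinm (c : nat) (b : 'X_{1..m}) : 'X_{1..1 + m} :=
  [multinom vjoin (fun _ : 'I_1 => c) b i | i < 1 + m].

Lemma joinmP c c' b b' : joinm c b = joinm c' b' -> c = c' /\ b = b'.
Proof.
move=> /mnmP H; split; last apply/mnmP => i.
  by have := H (lshift m ord0); rewrite !mnmE !vjoinl.
by have := H (rshift 1 i); rewrite !mnmE !vjoinr.
Qed.

Lemma joinmK (N : 'X_{1..1 + m}) : joinm (N (lshift m ord0)) (mright N) = N.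
Proof.
apply/mnmP => i; rewrite mnmE -(splitK i); case: (fintype.split i) => j /=.
  by rewrite vjoinl (ord1 j).
by rewrite vjoinr mnmE.
Qed.

Lemma wdeg_joinm c b : wdeg w (joinm c b) = (c * k + wdeg wy b)%N.
Proof.
rewrite /wdeg big_split_ord big_ord1 mnmE vjoinl; congr (_ + _)%N.
by apply: eq_bigr => i _; rewrite mnmE vjoinr.
Qed.

(** The weights once the first variable has been replaced by [n] variables of
    weight [1]. *)
Definition linear_weights n i := if (i < n)%N then 1%N else w (i - n).+1.

Lemma wdeg_linear n (M : 'X_{1..n + m}) :
  wdeg (linear_weights n) M = (mdeg (mleft M) + wdeg wy (mright M))%N.
Proof.
rewrite /wdeg mdegE big_split_ord; congr (_ + _)%N; apply: eq_bigr => i _; rewrite !mnmE.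
  by rewrite /linear_weights /= ltn_ord muln1.
by rewrite /linear_weights /= -ltn_subRL subnn ltn0 addKn.
Qed.

Definition X0 : {mpoly K[1 + m]} := 'X_(lshift m ord0).

Lemma joinmX c (b : 'X_{1..m}) :
  X0 ^+ c * \prod_j 'X_(rshift 1 j) ^+ b j = 'X_[joinm c b] :> {mpoly K[1 + m]}.
Proof.
rewrite [RHS]mpolyXE_id big_split_ord big_ord1 mnmE vjoinl; congr (_ * _).
by apply: eq_bigr => j _; rewrite mnmE vjoinr.
Qed.

Definition line_sub n (l : 'I_n -> K) : (n + m).-tuple {mpoly K[1 + m]} :=
  [tuple vjoin (fun j => l j *: X0) (fun j => 'X_(rshift 1 j)) i | i < n + m].

Definition power_sub : (1 + m).-tuple {mpoly K[1 + m]} :=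
  [tuple vjoin (fun _ => X0 ^+ k) (fun j => 'X_(rshift 1 j)) i | i < 1 + m].

Definition powersum_sub n : (1 + m).-tuple {mpoly K[n + m]} :=
  [tuple vjoin (fun _ => \sum_(j < n) 'X_(lshift m j) ^+ k) (fun j => 'X_(rshift n j)) i
    | i < 1 + m].

Lemma line_subX n (l : 'I_n -> K) M : 'X_[M] \mPo line_sub l =
  (\prod_j l j ^+ mleft M j) *: 'X_[joinm (mdeg (mleft M)) (mright M)].
Proof.
rewrite comp_mpolyX big_split_ord -joinmX scalerAl; congr (_ * _); last first.
  by apply: eq_bigr => j _; rewrite tnth_mktuple vjoinr mnmE.
rewrite mdegE -[X in _ *: X]prodrXr -scaler_prod.
by apply: eq_bigr => j _; rewrite tnth_mktuple vjoinl exprZn mnmE.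
Qed.

Definition spread (M : 'X_{1..1 + m}) := joinm (M (lshift m ord0) * k) (mright M).

Lemma spread_inj : injective spread.
Proof.
move=> M M' /joinmP[/eqP]; rewrite eqn_pmul2r // => /eqP MM rr.
by rewrite -(joinmK M) -(joinmK M') MM rr.
Qed.

Lemma power_subX M : 'X_[M] \mPo power_sub = 'X_[spread M].
Proof.
rewrite comp_mpolyX big_split_ord big_ord1 -joinmX mulnC exprM tnth_mktuple vjoinl; congr (_ * _).
by apply: eq_bigr => j _; rewrite tnth_mktuple vjoinr mnmE.
Qed.

Lemma mcoeff_power_sub q N : (q \mPo power_sub)@_(spread N) = q@_N.
Proof.
rewrite comp_mpolyEX [in RHS](mpolyE q) !raddf_sum; apply: eq_bigr => M _ /=.
by rewrite power_subX !mcoeffZ !mcoeffX (inj_eq spread_inj).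
Qed.

Lemma powersum_line n (l : 'I_n -> K) P : \sum_j l j ^+ k = 1 ->
  (P \mPo powersum_sub n) \mPo line_sub l = P \mPo power_sub.
Proof.
move=> l1; rewrite comp_mpoly_comp; congr (_ \mPo _); apply: eq_mktuple => i.
rewrite -(splitK i); case: (fintype.split i) => j /=; rewrite ?(vjoinl, vjoinr).
  rewrite raddf_sum (eq_bigr (fun i => l i ^+ k *: X0 ^+ k)) => [|i' _].
    by rewrite -scaler_suml l1 scale1r.
  by rewrite /= rmorphXn /= comp_mpolyXU -tnth_nth tnth_mktuple vjoinl exprZn.
by rewrite comp_mpolyXU -tnth_nth tnth_mktuple vjoinr.
Qed.

Section Folding.
Variables (d n deg : nat) (g : {mpoly K[n + m]}) (l : 'I_n -> K).
Hypotheses (deg_le : (deg <= d)%N).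
Hypothesis g_homog : g \is deg.-homog for (@wdeg (linear_weights n) (n + m)).

Lemma xcoef_wdeg (b : 'X_{1..m}) : xcoef g b \is (deg - wdeg wy b).-homog.
Proof.
apply: xcoef_homog => M MG <-.
by rewrite -(wdeg_homog g_homog MG) wdeg_linear addnK.
Qed.

(** On the line through [l], the polynomial [g] becomes a polynomial in the [k]-th power of the
    parameter as soon as [l] kills the coefficients of the wrong degrees
    ([line_sub_fold]); [fold_form] is that polynomial. *)
Definition fold_form : {mpoly K[1 + m]} :=
  \sum_(b : 'X_{1..m < d.+1} | (wdeg wy b <= deg)%N && (k %| deg - wdeg wy b)%N)
    (xcoef g b).@[l] *: 'X_[joinm ((deg - wdeg wy b) %/ k) b].

Lemma fold_homog : fold_form \is deg.-homog for (@wdeg w (1 + m)).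
Proof.
apply: rpred_sum => b /andP[bd kb]; apply: rpredZ; rewrite dhomogX; apply/eqP.
by apply: etrans (wdeg_joinm _ _) _; rewrite divnK // subnK.
Qed.

Lemma line_sub_fold :
  (forall b : 'X_{1..m < d.+1}, (wdeg wy b <= deg)%N -> ~~ (k %| deg - wdeg wy b)%N ->
     (xcoef g b).@[l] = 0) ->
  g \mPo line_sub l = fold_form \mPo power_sub.
Proof.
move=> g0; have wM M : M \in msupp g -> (mdeg (mleft M) + wdeg wy (mright M))%N = deg.
  by move=> /(wdeg_homog g_homog) <-; rewrite wdeg_linear.
rewrite /fold_form raddf_sum.
transitivity (\sum_(b : 'X_{1..m < d.+1}) (xcoef g b).@[l] *: 'X_[joinm (deg - wdeg wy b) b] :
    {mpoly K[1 + m]}); last first.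
  rewrite [RHS]big_mkcond; apply: eq_bigr => b _; case: ifPn => [/andP[bd kb]|].
    rewrite /= comp_mpolyZ power_subX /spread; congr (_ *: 'X_[joinm _ _]).
      by rewrite mnmE vjoinl divnK.
    by apply/mnmP => i; rewrite !mnmE vjoinr.
  rewrite negb_and => /orP[bd|kb]; last first.
    have [bd|bd] := leqP (wdeg wy b) deg; first by rewrite g0 // scale0r.
    by rewrite (eqP (_ : deg - wdeg wy b == 0)%N) ?dvdn0 // subn_eq0 ltnW in kb.
  rewrite xcoef_eq0 ?meval0 ?scale0r // => M /wM Md; apply: contraNneq bd => <-.
  by rewrite -Md leq_addl.
rewrite comp_mpolyEX.
pose c M := g@_M * \prod_j l j ^+ mleft M j.
transitivity (\sum_(M <- msupp g) c M *: 'X_[joinm (mdeg (mleft M)) (mright M)] : {mpoly K[1 + m]}).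
  by apply: eq_bigr => M _; rewrite line_subX scalerA.
transitivity (\sum_(b : 'X_{1..m < d.+1}) \sum_(M <- msupp g | mright M == b)
    c M *: 'X_[joinm (deg - wdeg wy b) b] : {mpoly K[1 + m]}); last first.
  apply: eq_bigr => b _; rewrite -scaler_suml; congr (_ *: _).
  rewrite /xcoef raddf_sum; apply: eq_bigr => M _ /=.
  by rewrite mevalZ mevalX.
rewrite (exchange_big_dep xpredT) //= !big_seq; apply: eq_bigr => M /wM Md.
have bM : (mdeg (mright M) < d.+1)%N.
  by rewrite ltnS (leq_trans (mdeg_wdeg _ wy_gt0)) // (leq_trans _ deg_le) // -Md leq_addl.
rewrite (big_pred1 (BMultinom bM)); first by rewrite /= -Md addnK.
by move=> b /=; rewrite eq_sym; exact: (esym (bmeqP b (BMultinom bM))).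
Qed.

End Folding.

Hypothesis charK0 : [pchar K] =i pred0.
Variables (d r : nat) (e : 'I_r -> nat).
Hypothesis e_bnd : forall i, (1 <= e i <= d - 1)%N.

(** The form [P \mPo powersum_sub n] is the limit at a place of sums of products of
    forms. The coefficients of the factors, with respect to the last variables, whose
    degree in the first ones is not divisible by [k] are forms whose number and
    degrees do not depend on [n]. For large [n] they have a common zero [l] with
    power sum [1], and on the line through it the sums of products become sums of
    products in the [k]-th power of the parameter. As [l] is bounded, the limit
    passes through. *)
Lemma powersum_detects : exists n, forall P : {mpoly K[1 + m]},
  wborder d e (linear_weights n) (P \mPo powersum_sub n) -> wborder d e w P.
Proof.
pose deg (s : bool) i := if s then e i else (d - e i)%N.
have degd s i : (deg s i <= d)%N by rewrite /deg; case: s; have := e_bnd i; lia.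
pose Q (z : bool * 'I_r * 'X_{1..m < d.+1}) :=
  (wdeg wy z.2 <= deg z.1.1 z.1.2)%N && ~~ (k %| deg z.1.1 z.1.2 - wdeg wy z.2)%N.
pose T : finType := {z | Q z}.
pose et (t : T) := (deg (val t).1.1 (val t).1.2 - wdeg wy (val t).2)%N.
have [n sol] : solvable K k et.
  by apply: isotropic_system => // t; case/andP: (valP t).
exists n => P; set F := P \mPo _ => FX.
have [pl plF] := border_place FX.
set I := strength_param K r (n + m) in pl plF.
pose mu := @strength_val K d r e (linear_weights n) (n + m).
pose g s (x : I) i := if s then lfactor e (linear_weights n) x i
  else rfactor d e (linear_weights n) x i.
have gh s x i : g s x i \is (deg s i).-homog for (@wdeg (linear_weights n) (n + m)).
  by rewrite /g; case: s; apply: pihomogP.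
pose G (t : T) (x : I) := xcoef (g (val t).1.1 x (val t).1.2) (val t).2.
have Gh t x : G t x \is (et t).-homog by apply: xcoef_wdeg.
have [l [bl Pl]] := sol I pl G Gh.
have [c lc] : exists c : 'I_n -> K, forall j, pl (l j) (c j).
  by have [c cE] := choice bl; exists c.
pose Qx (x : I) := \sum_i fold_form d (deg true i) (g true x i) (fun j => l j x) *
   fold_form d (deg false i) (g false x i) (fun j => l j x).
have QX x : wstrength d e w (Qx x).
  by eexists; eexists; split; last (by []); move=> i; apply: fold_homog.
have muQ : large pl [set x | mu x \mPo line_sub (fun j => l j x) = Qx x \mPo power_sub].
  apply: largeS Pl => x /= [lG _]; rewrite /Qx.
  rewrite (raddf_sum (comp_mpoly (line_sub _))) (raddf_sum (comp_mpoly power_sub)).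
  apply: eq_bigr => i _.
  have H s : g s x i \mPo line_sub (fun j => l j x) =
      fold_form d (deg s i) (g s x i) (fun j => l j x) \mPo power_sub.
    apply: line_sub_fold => // b bd kb.
    have Qb : Q (s, i, b) by rewrite /Q /= bd kb.
    exact: (lG (exist (fun z => is_true (Q z)) _ Qb)).
  by apply: etrans (comp_mpolyM _ _ _) (etrans _ (esym (comp_mpolyM _ _ _))); rewrite -!H.
have c1 : \sum_j c j ^+ k = 1.
  have : pl (fun x => \sum_j l j x ^+ k) (\sum_j c j ^+ k).
    apply: tends_sum => j _; rewrite (_ : (fun x => _) = l j ^+ k); first exact: tends_exp.
    by apply: funext => x; elim: (k) => // a IH; rewrite !exprS IH.
  move=> H; apply: tends_uniq H _; apply: tends_large Pl _ (tends1 pl).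
  by move=> x [_ ->].
have wl0 i : (i < n + m)%N -> (0 < linear_weights n i)%N.
  rewrite /linear_weights => im; case: ifPn => //; rewrite -leqNgt => ni.
  by apply: wy_gt0; rewrite ltn_subLR.
have muh x : mu x \is d.-homog for (@wdeg (linear_weights n) (n + m)).
  apply: (wstrength_homog e_bnd).
  exists (lfactor e (linear_weights n) x), (rfactor d e (linear_weights n) x).
  by split=> // i; apply: pihomogP.
have sub_coef (G' : {mpoly K[n + m]}) (a : 'I_n -> K) N :
    (forall M, (d < mdeg M)%N -> G'@_M = 0) ->
    (G' \mPo line_sub a)@_N = \sum_(M : bmultinom (n + m) d.+1) G'@_M *
      ((\prod_j a j ^+ mleft M j) * (joinm (mdeg (mleft M)) (mright M) == N)%:R).
  move=> G0; have sz : (msize G' <= d.+1)%N.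
    apply: msize_leP => M; rewrite mcoeff_msupp ltnS leqNgt; apply: contra => dM.
    by rewrite G0.
  rewrite (comp_mpolywE _ sz) (raddf_sum (mcoeff N)); apply: eq_bigr => M _ /=.
  by rewrite mcoeffZ -comp_mpolyX line_subX mcoeffZ mcoeffX.
have lim N : pl (fun x => (mu x \mPo line_sub (fun j => l j x))@_N) (F \mPo line_sub c)@_N.
  rewrite sub_coef; last by move=> M; apply: (wborder_mdeg e_bnd wl0 FX).
  rewrite (_ : (fun x => _) = fun x => \sum_(M : bmultinom (n + m) d.+1) (mu x)@_M *
      ((\prod_j l j x ^+ mleft M j) * (joinm (mdeg (mleft M)) (mright M) == N)%:R)).
    apply: tends_sum => M _; apply: tends_mul (plF M) _.
    apply: tends_mul (tends_cst pl _); apply: tends_prod => j _.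
    rewrite (_ : (fun x => _) = l j ^+ mleft M j); first exact: tends_exp.
    by apply: funext => x; elim: (mleft M j) => // a IH; rewrite !exprS IH.
  apply: funext => x; apply: sub_coef => M dM; apply: (dhomog_nemf_coeff (muh x)).
  by apply: contraTneq dM => /= <-; rewrite -leqNgt mdeg_wdeg.
have limQ N : pl (fun x => (Qx x)@_N) P@_N.
  rewrite -mcoeff_power_sub -(powersum_line _ c1).
  apply: tends_large muQ _ (lim (spread N)) => x /= ->.
  exact: mcoeff_power_sub.
have w0 i : (i < 1 + m)%N -> (0 < w i)%N by case: i => // i im; apply: wy_gt0.
have Q0 x N : (d < mdeg N)%N -> (Qx x)@_N = 0.
  move=> dN; apply: (dhomog_nemf_coeff (wstrength_homog e_bnd (QX x))).
  by apply: contraTneq dN => /= <-; rewrite -leqNgt mdeg_wdeg.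
have P0 N : (d < mdeg N)%N -> P@_N = 0.
  move=> dN; apply: tends_uniq (limQ N) _; rewrite (_ : (fun x => _) = 0); first exact: tends0.
  by apply: funext => x; apply: Q0.
have expand (p : {mpoly K[1 + m]}) : (forall N, (d < mdeg N)%N -> p@_N = 0) ->
    p = \sum_(N : bmultinom (1 + m) d.+1) p@_N *: 'X_[N].
  move=> p0; apply: mpolywE; apply: msize_leP => N; rewrite mcoeff_msupp ltnS leqNgt.
  by apply: contra => dN; rewrite p0.
apply/zariski_closureP => E pE EX.
have : pl (fun x => E (\sum_(N : bmultinom (1 + m) d.+1) (Qx x)@_N *: 'X_[N]))
    (E (\sum_(N : bmultinom (1 + m) d.+1) P@_N *: 'X_[N])).
  exact: (tends_polynomial_fun (P := pl) (fun N : bmultinom (1 + m) d.+1 => 'X_[N]) pE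
    (a := fun N x => (Qx x)@_N)).
rewrite -expand // (_ : (fun x => _) = 0); first exact: tends_eq0.
by apply: funext => x; rewrite -expand ?EX // => N; apply: Q0.
Qed.

End OneVariable.

Section Detection.
Variables (K : closedFieldType) (d r : nat) (e : 'I_r -> nat).
Hypothesis charK0 : [pchar K] =i pred0.
Hypothesis e_bnd : forall i, (1 <= e i <= d - 1)%N.

Lemma var_homog (w : nat -> nat) n (j : 'I_n) a : w j = a ->
  'X_j \is [in K[n], a.-homog for (@wdeg w n)].
Proof.
move=> <-; rewrite dhomogX; apply/eqP; rewrite -[LHS]/(wdeg w _) /wdeg (bigD1 j) //= mnm1E eqxx mul1n.
by rewrite big1 ?addn0 // => i ij; rewrite mnm1E eq_sym (negbTE ij).
Qed.

(** The power sum substitutions are iterated, once for each of the variables: after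
    each step the new variables, of weight [1], are rotated to the end. *)
Theorem weights_detect p (w : nat -> nat) : (forall i, (i < p)%N -> (0 < w i)%N) ->
  exists q (v : 'I_p -> {mpoly K[q]}), (forall j, v j \is (w j).-homog) /\
    forall P : {mpoly K[p]},
      wborder d e (fun=> 1%N) (P \mPo [tuple v j | j < p]) -> wborder d e w P.
Proof.
(* only the first c variables may have a weight other than 1 *)
suff claim c : forall p (w : nat -> nat), (forall i, (i < p)%N -> (0 < w i)%N) ->
    (forall i, (c <= i < p)%N -> w i = 1%N) ->
    exists q (v : 'I_p -> {mpoly K[q]}),
      (forall j, v j \is (w j).-homog for (@wdeg (fun=> 1%N) q)) /\
      forall P : {mpoly K[p]},
      wborder d e (fun=> 1%N) (P \mPo [tuple v j | j < p]) -> wborder d e w P.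
  move=> w0; have [|q [v [vh vP]]] := claim p p w w0; first by move=> i; lia.
  by exists q, v; split=> // j; rewrite -wdeg1_homog.
elim: c => [|c IH] {}p {}w w0 w1.
  exists p, (fun j => 'X_j); split=> [j|P]; first by apply: var_homog; rewrite w1 // ltn_ord.
  rewrite comp_mpoly_id => PX; rewrite -(comp_mpoly_id P).
  by apply: wborder_comp PX => j; apply: var_homog; rewrite w1 // ltn_ord.
case: p w0 w1 => [|m] w0 w1; first by apply: IH => // i; rewrite ltn0 andbF.
have [n nP] := @powersum_detects K m w (w0 0%N isT) (fun i im => w0 i.+1 im) charK0 d r e e_bnd.
pose w' i := if (i < m)%N then w i.+1 else 1%N.
have [||q [v [vh vP]]] := IH (m + n)%N w'.
- by move=> i _; rewrite /w'; case: ifP => // im; apply: (w0 i.+1).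
- by move=> i; rewrite /w'; case: ifP => // im ci; apply: w1; lia.
pose rho : 'I_(n + m) -> {mpoly K[m + n]} :=
  vjoin (fun i => 'X_(rshift m i)) (fun j => 'X_(lshift n j)).
pose rho' : 'I_(m + n) -> {mpoly K[n + m]} :=
  vjoin (fun j => 'X_(rshift n j)) (fun i => 'X_(lshift m i)).
pose ps : 'I_(1 + m) -> {mpoly K[n + m]} :=
  vjoin (fun _ => \sum_(j < n) 'X_(lshift m j) ^+ w 0) (fun j => 'X_(rshift n j)).
have rhoh j : rho j \is (linear_weights w n j).-homog for (@wdeg w' (m + n)).
  rewrite -(splitK j); case: (fintype.split j) => i; rewrite /rho /= ?vjoinl ?vjoinr;
    apply: var_homog; rewrite /w' /linear_weights /=.
    by rewrite ltn_ord ltnNge leq_addr.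
  by rewrite ltn_ord ltnNge leq_addr /= addKn.
have rhoh' j : rho' j \is (w' j).-homog for (@wdeg (linear_weights w n) (n + m)).
  rewrite -(splitK j); case: (fintype.split j) => i; rewrite /rho' /= ?vjoinl ?vjoinr;
    apply: var_homog; rewrite /w' /linear_weights /=.
    by rewrite ltn_ord ltnNge leq_addr /= addKn.
  by rewrite ltn_ord ltnNge leq_addr.
have psh j : ps j \is (w j).-homog for (@wdeg (linear_weights w n) (n + m)).
  rewrite -(splitK j); case: (fintype.split j) => i; rewrite /ps /= ?vjoinl ?vjoinr.
    rewrite (ord1 i); apply: rpred_sum => l _.
    have X1 : 'X_(lshift m l) \is [in K[n + m], 1.-homog for (@wdeg (linear_weights w n) (n + m))].
      by apply: var_homog; rewrite /linear_weights /= ltn_ord.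
    by have := dhomogMn (w 0%N) X1; rewrite mul1n.
  by apply: var_homog; rewrite /linear_weights /= ltnNge leq_addr /= addKn.
exists q, (fun j => (ps j \mPo [tuple rho i | i < n + m]) \mPo [tuple v i | i < m + n]); split.
  by move=> j; apply: comp_homog vh; apply: comp_homog rhoh.
move=> P; rewrite -(comp_mpoly_comp _ (fun j => ps j \mPo _)) -comp_mpoly_comp => /vP.
move=> /(wborder_comp rhoh'); move=> PX.
apply: nP; move: PX; congr (wborder _ _ _ _).
rewrite (comp_mpoly_comp _ rho) -[RHS]comp_mpoly_id; congr (_ \mPo _); apply: eq_mktuple => j.
rewrite -(splitK j); case: (fintype.split j) => i; rewrite /rho /= ?vjoinl ?vjoinr;
  by rewrite comp_mpolyXU -tnth_nth tnth_mktuple /rho' ?vjoinl ?vjoinr.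
Qed.

End Detection.

(** * Vanishing polynomials and generated algebras *)

Section Vanishing.
Variable K : fieldType.
Hypothesis charK0 : [pchar K] =i pred0.

Lemma natr_neq0 k : (0 < k)%N -> k%:R != 0 :> K.
Proof. by move/pcharf0P: charK0 => ->; rewrite -lt0n. Qed.

Lemma poly_vanish (p : {poly K}) : (forall a, p.[a] = 0) -> p = 0.
Proof.
move=> p0; apply/eqP; apply: contraT => pn0.
have natI : injective (fun i : nat => i%:R : K).
  move=> i j; wlog ij : i j / (i <= j)%N => [H|E].
    by have [/H|/ltnW/H H' /esym/H' ->] := leqP i j.
  apply/eqP; rewrite eqn_leq ij /= -subn_eq0 -leqn0 leqNgt; apply/negP => /natr_neq0.
  by rewrite natrB // E subrr eqxx.
have : (size [seq i%:R : K | i <- iota 0 (size p)] < size p)%N.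
  apply: max_poly_roots => //; first by apply/allP => a _; rewrite /root p0.
  by rewrite map_inj_uniq // iota_uniq.
by rewrite size_map size_iota ltnn.
Qed.

Lemma mcoeff_xcoef n m (G : {mpoly K[n + m]}) M : (xcoef G (mright M))@_(mleft M) = G@_M.
Proof.
rewrite /xcoef raddf_sum /= [in RHS](mpolyE G) raddf_sum /= big_mkcond.
apply: eq_bigr => M' _; rewrite [RHS]mcoeffZ mcoeffX; case: eqP => [rr|rr]; last first.
  by case: eqP => [E|]; rewrite ?mulr0 //; rewrite E in rr.
rewrite mcoeffZ mcoeffX; congr (_ * _%:R); congr nat_of_bool.
by apply/eqP/eqP => [ll|-> //]; apply: mleft_rightP.
Qed.

Lemma mpoly_vanish n (p : {mpoly K[n]}) : (forall x, p.@[x] = 0) -> p = 0.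
Proof.
elim: n p => [|n IH] p p0.
  have := p0 (fun _ => 0); rewrite (nvar0_mpolyC p) mevalC => ->.
  exact: mpolyC0.
have one (q : {mpoly K[1]}) : (forall x, q.@[x] = 0) -> q = 0.
  move=> q0; pose f : {poly K} := \sum_(M <- msupp q) q@_M *: 'X^(M ord0).
  have fz : f = 0.
    apply: poly_vanish => a; rewrite -[RHS](q0 (fun _ => a)) mevalE horner_sum.
    by apply: eq_bigr => M _; rewrite hornerZ hornerXn big_ord1.
  apply/mpolyP => M; rewrite mcoeff0 -[RHS](coef0 _ (M ord0)) -fz [in LHS](mpolyE q).
  rewrite raddf_sum coef_sum; apply: eq_bigr => M' _ /=.
  rewrite mcoeffZ mcoeffX coefZ coefXn; congr (_ * _%:R); congr nat_of_bool.
  apply/eqP/eqP => [-> //|E]; apply/mnmP => i; by rewrite (ord1 i).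
move: p p0; rewrite -[n.+1]/(1 + n)%N => p p0.
apply/mpolyP => M; rewrite mcoeff0 -mcoeff_xcoef.
suff -> : xcoef p (mright M) = 0 by rewrite mcoeff0.
apply: one => x; rewrite -mcoeff_xeval (IH (xeval p x)) ?mcoeff0 // => y.
by rewrite meval_xeval.
Qed.

Lemma mderiv_neq0 n (p : {mpoly K[n]}) : (forall c, p <> c%:MP) -> exists i, p^`M(i) != 0.
Proof.
move=> pc; apply: contrapT => nd; apply: (pc p@_0%MM); apply/mpolyP => M.
rewrite mcoeffC; case: eqP => [->|M0]; rewrite ?mulr1 ?mulr0 //.
have [i Mi] : exists i, M i != 0%N.
  apply: contrapT => nM; apply: M0; apply/mnmP => i; rewrite mnm0E.
  by apply: contrapT => Mi; apply: nM; exists i; apply/eqP.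
have pi : p^`M(i) = 0 by apply: contrapT => /eqP pi; apply: nd; exists i.
have := mcoeff_deriv i (M - U_(i))%MM p; rewrite pi mcoeff0 submK ?lep1mP //.
move/esym/eqP; rewrite -mulr_natr mulf_eq0 => /orP[/eqP //|].
by rewrite (negbTE (natr_neq0 _)).
Qed.

Lemma msize_deriv n (p : {mpoly K[n]}) i : p != 0 -> (msize p^`M(i) < msize p)%N.
Proof.
move=> p0; rewrite -(prednK (_ : 0 < msize p)%N) ?lt0n ?msize_poly_eq0 // ltnS.
apply: msize_leP => M; rewrite mcoeff_msupp mcoeff_deriv => pM.
have : (M + U_(i))%MM \in msupp p.
  by rewrite mcoeff_msupp; apply: contraNneq pM => ->; rewrite mul0rn.
move=> /msize_mdeg_lt; rewrite mdegD mdeg1 addn1.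
by case: (msize p).
Qed.

Definition linform n (c : 'I_n -> K) : {mpoly K[n]} := \sum_b c b *: 'X_b.

(** The factor [a] is a multinomial coefficient; only that it does not vanish matters. *)
Lemma linform_power n k (m : 'X_{1..n}) : mdeg m = k ->
  exists2 a : nat, (0 < a)%N &
    forall c, (linform c ^+ k)@_m = a%:R * \prod_b c b ^+ m b.
Proof.
elim: k m => [|k IH] m.
  move/eqP; rewrite mdeg_eq0 => /eqP ->; exists 1%N => // c.
  by rewrite expr0 mcoeff1 eqxx mul1r big1 // => b _; rewrite mnm0E.
move=> mk; have step c : (linform c ^+ k.+1)@_m =
    \sum_(b | m b != 0%N) c b * (linform c ^+ k)@_(m - U_(b))%MM.
  rewrite exprSr {2}/linform mulr_sumr raddf_sum [RHS]big_mkcond; apply: eq_bigr => b _ /=.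
  rewrite -scalerAr mcoeffZ; case: ifPn => [mb|mb].
    congr (_ * _); have mE := submK (_ : U_(b) <= m)%MM.
    by rewrite -[X in _@_X = _]mE ?lep1mP // addmC mcoeffMX.
  rewrite [X in _ * X](_ : _ = 0) ?mulr0 //.
  apply: memN_msupp_eq0; apply/negP; rewrite (perm_mem (msuppMX _ _)) => /mapP[M _ E].
  by rewrite E mnmDE mnm1E eqxx in mb.
have exa b : exists a : nat, m b != 0%N -> (0 < a)%N /\ forall c,
    (linform c ^+ k)@_(m - U_(b))%MM = a%:R * \prod_b' c b' ^+ (m - U_(b))%MM b'.
  have [mb|mb] := eqVneq (m b) 0%N; first by exists 0%N.
  have [|a a0 aE] := IH (m - U_(b))%MM; last by exists a.
  have mE : (m - U_(b) + U_(b))%MM = m by rewrite submK ?lep1mP.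
  by have := mk; rewrite -{1}mE mdegD mdeg1 addn1 => -[].
have [a aP] := choice exa.
exists (\sum_(b | m b != 0%N) a b)%N.
  have [b mb] : exists b, m b != 0%N.
    apply: contrapT => nm; have : mdeg m = 0%N; last by rewrite mk.
    rewrite mdegE big1 // => b _; apply: contrapT => mb; apply: nm; exists b; exact/eqP.
  by rewrite (bigD1 b) //= ltn_addr // (aP b mb).1.
move=> c; rewrite step natr_sum mulr_suml; apply: eq_bigr => b mb.
rewrite (aP b mb).2 mulrCA; congr (_ * _).
rewrite (bigD1 b) //= [RHS](bigD1 b) //= mulrA -exprS; congr (_ ^+ _ * _).
  by rewrite mnmBE mnm1E eqxx subn1 prednK // lt0n.
by apply: eq_bigr => b' b'b; rewrite mnmBE mnm1E eq_sym (negbTE b'b) subn0.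
Qed.

End Vanishing.

Section GeneratedAlgebra.
Variables (K : fieldType) (n : nat).
Implicit Types (gen : set {mpoly K[n]}) (F : {mpoly K[n]}).

Definition generated gen : set {mpoly K[n]} := [set F | forall S : set {mpoly K[n]},
  (forall c, S c%:MP) -> gen `<=` S -> (forall f g, S f -> S g -> S (f + g)) ->
  (forall f g, S f -> S g -> S (f * g)) -> S F].

Lemma generated_cst gen c : generated gen c%:MP. Proof. by move=> S. Qed.

Lemma generated_gen gen : gen `<=` generated gen.
Proof. by move=> F gF S _ + _ _; apply. Qed.

Lemma generatedD gen f g : generated gen f -> generated gen g -> generated gen (f + g).
Proof. by move=> Gf Gg S c s a m; exact: a (Gf S c s a m) (Gg S c s a m). Qed.

Lemma generatedM gen f g : generated gen f -> generated gen g -> generated gen (f * g).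
Proof. by move=> Gf Gg S c s a m; exact: m (Gf S c s a m) (Gg S c s a m). Qed.

Lemma generatedZ gen c f : generated gen f -> generated gen (c *: f).
Proof. by move=> Gf; rewrite -mul_mpolyC; apply: generatedM Gf; apply: generated_cst. Qed.

Lemma generated0 gen : generated gen 0.
Proof. by rewrite -mpolyC0; apply: generated_cst. Qed.

Lemma generated_sum gen (J : Type) (s : seq J) (Q : pred J) (G : J -> {mpoly K[n]}) :
  (forall j, Q j -> generated gen (G j)) -> generated gen (\sum_(j <- s | Q j) G j).
Proof.
move=> QG; apply: big_ind => //; [exact: generated0 | exact: generatedD].
Qed.

Lemma generated_sub gen gen' : gen `<=` generated gen' -> generated gen `<=` generated gen'.
Proof.
move=> gg F FG; apply: (FG (generated gen')) => //.
- exact: generated_cst.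
- exact: generatedD.
- exact: generatedM.
Qed.

Lemma generated_comp p (U : 'I_p -> {mpoly K[n]}) F :
  generated (range U) F -> exists P : {mpoly K[p]}, F = P \mPo [tuple U j | j < p].
Proof.
move=> FG; apply: (FG [set F | exists P : {mpoly K[p]}, F = P \mPo [tuple U j | j < p]])
  => [c|_ [j _ <-]|_ _ [P ->] [Q ->]|_ _ [P ->] [Q ->]].
- by exists c%:MP; rewrite comp_mpolyC.
- by exists 'X_j; rewrite comp_mpolyXU -tnth_nth tnth_mktuple.
- by exists (P + Q); rewrite comp_mpolyD.
- by exists (P * Q); rewrite comp_mpolyM.
Qed.

Lemma mpoly_alg_ind (S : {mpoly K[n]} -> Prop) : (forall c, S c%:MP) -> (forall i, S 'X_i) ->
  (forall f g, S f -> S g -> S (f + g)) -> (forall f g, S f -> S g -> S (f * g)) ->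
  forall f, S f.
Proof.
move=> SC SX SD SM f; rewrite (mpolyE f); apply: big_ind => //.
  by rewrite -mpolyC0.
move=> M _; rewrite -mul_mpolyC; apply: (SM) => //; rewrite mpolyXE_id.
apply: big_ind => // [|i _]; first by rewrite -mpolyC1.
by elim: (M i) => [|a IH]; [rewrite expr0 -mpolyC1 | rewrite exprS; apply: SM].
Qed.

End GeneratedAlgebra.

(** * Expansions along a direction *)

Section Taylor.
Variables (K : fieldType) (N n : nat) (c : 'I_N -> {poly {mpoly K[n]}}).

(** Locked because unification would otherwise unfold the evaluation morphism. *)
Definition peval : {mpoly K[N]} -> {poly {mpoly K[n]}} :=
  locked (mmap (polyC \o @mpolyC n K) c).

Lemma pevalC a : peval a%:MP = a%:MP%:P.
Proof. by rewrite /peval -lock mmapC. Qed.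

Lemma pevalX i : peval 'X_i = c i.
Proof. by rewrite /peval -lock mmapX mmap1U. Qed.

Lemma pevalD f g : peval (f + g) = peval f + peval g.
Proof. by rewrite /peval -lock mmapD. Qed.

Lemma pevalM f g : peval (f * g) = peval f * peval g.
Proof. by rewrite /peval -lock rmorphM. Qed.

Lemma peval_eval f s x : ((peval f).[s%:MP]).@[x] = f.@[fun a => ((c a).[s%:MP]).@[x]].
Proof.
elim/mpoly_alg_ind: f => [a|i|f g IHf IHg|f g IHf IHg].
- by rewrite pevalC hornerC !mevalC.
- by rewrite pevalX mevalXU.
- by rewrite pevalD hornerD [LHS]mevalD [RHS]mevalD; congr (_ + _); [exact: IHf | exact: IHg].
- by rewrite pevalM hornerM [LHS]mevalM [RHS]mevalM; congr (_ * _); [exact: IHf | exact: IHg].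
Qed.

Variables (C0 : 'I_N -> K) (k : nat) (gen : set {mpoly K[n]}).
Hypothesis k_gt0 : (0 < k)%N.
Hypothesis cC0 : forall a, (c a)`_0 = (C0 a)%:MP.
Hypothesis c_gen : forall a i, (0 < i < k)%N -> generated gen (c a)`_i.

(** A product of coefficients of total degree [k] is linear in the coefficients of degree [k]
    up to products of lower ones, which are in the algebra generated by [gen]. *)
Lemma peval_taylor f :
  [/\ (peval f)`_0 = (f.@[C0])%:MP,
      forall i, (0 < i < k)%N -> generated gen (peval f)`_i &
      generated gen ((peval f)`_k - \sum_a (f^`M(a)).@[C0] *: (c a)`_k)].
Proof.
elim/mpoly_alg_ind: f => [a|i|f g [f0 fi fk] [g0 gi gk]|f g [f0 fi fk] [g0 gi gk]].
- rewrite pevalC; split=> [|i ik|]; rewrite coefC ?mevalC //.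
    by case: i ik => // i _; apply: generated0.
  rewrite ifN -?lt0n // big1; last by move=> b _; rewrite mderivC meval0 scale0r.
  by rewrite subrr; apply: generated0.
- rewrite pevalX; split=> [|j jk|]; rewrite ?mevalXU //; first exact: c_gen.
  rewrite (bigD1 i) //= big1 => [|b bi].
    rewrite mderivX mnm1E eqxx scale1r (_ : (U_(i) - U_(i))%MM = 0%MM).
      by rewrite mpolyX0 meval1 scale1r addr0 subrr; apply: generated0.
    by apply/mnmP => j; rewrite mnmBE subnn mnm0E.
  by rewrite mderivX mnm1E eq_sym (negbTE bi) scale0r meval0 scale0r.
- rewrite pevalD; split=> [|i ik|]; rewrite coefD.
  + by rewrite mevalD f0 g0 mpolyCD.
  + by apply: generatedD; [apply: fi | apply: gi].
  + rewrite (eq_bigr (fun a => (f^`M(a)).@[C0] *: (c a)`_k + (g^`M(a)).@[C0] *: (c a)`_k)).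
      by rewrite big_split opprD addrACA; apply: generatedD.
    by move=> a _; rewrite mderivD mevalD scalerDl.
- rewrite pevalM; split=> [|i ik|].
  + by rewrite coefM big_ord1 subn0 f0 g0 mevalM mpolyCM.
  + rewrite coefM; apply: generated_sum => j _; apply: generatedM.
      case: (posnP j) => [->|j0]; first by rewrite f0; apply: generated_cst.
      by apply: fi; rewrite j0; have := ltn_ord j; lia.
    have [->|ji] := eqVneq (j : nat) i; first by rewrite subnn g0; apply: generated_cst.
    by apply: gi; have := ltn_ord j; lia.
  + rewrite (eq_bigr (fun a => g.@[C0] *: ((f^`M(a)).@[C0] *: (c a)`_k) +
        f.@[C0] *: ((g^`M(a)).@[C0] *: (c a)`_k))); last first.
      by move=> a _; rewrite mderivM mevalD !mevalM scalerDl !scalerA mulrC.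
    rewrite big_split -!scaler_sumr coefM; case: k k_gt0 fi fk gi gk => // k' _ fi fk gi gk.
    rewrite big_ord_recl big_ord_recr /= subn0 subnn f0 g0 mul_mpolyC [_ * _%:MP]mulrC mul_mpolyC.
    set mid := \sum_(i < k') _.
    have midG : generated gen mid.
      apply: generated_sum => j _; rewrite /= /bump leq0n add1n.
      by apply: generatedM; [apply: fi | apply: gi]; have := ltn_ord j; lia.
    set df := \sum_a _; set dg := \sum_a _.
    rewrite (_ : _ - _ = f.@[C0] *: ((peval g)`_k'.+1 - dg) +
        (g.@[C0] *: ((peval f)`_k'.+1 - df) + mid)).
      by apply: generatedD; [exact: generatedZ | apply: generatedD midG; exact: generatedZ].
    by rewrite !scalerBr; ring.
Qed.

End Taylor.

Section TopCoefficient.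
Variables (K : fieldType) (n q : nat).
Implicit Types (al : 'I_n -> {mpoly K[q]}) (x : 'I_n -> K) (ell : {mpoly K[q]}).

(** The form at [al + t x ell], expanded in powers of [t]. *)
Definition pencil al x ell : {mpoly K[n]} -> {poly {mpoly K[q]}} :=
  locked (mmap (polyC \o @mpolyC q K) (fun i => (al i)%:P + (x i *: ell) *: 'X)).

Lemma pencil_eval al x ell G s :
  (pencil al x ell G).[s%:MP] = G \mPo [tuple al i + (s * x i) *: ell | i < n].
Proof.
rewrite /pencil -lock; elim/mpoly_alg_ind: G => [a|i|f g IHf IHg|f g IHf IHg].
- by rewrite mmapC /= hornerC comp_mpolyC.
- rewrite mmapX mmap1U comp_mpolyXU -tnth_nth tnth_mktuple !hornerE.
  by rewrite mulrC mul_mpolyC scalerA.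
- by rewrite mmapD hornerD comp_mpolyD; congr (_ + _); [exact: IHf | exact: IHg].
- by rewrite rmorphM hornerM comp_mpolyM; congr (_ * _); [exact: IHf | exact: IHg].
Qed.

Lemma pencil_top al x ell e G : G \is e.-homog ->
  (size (pencil al x ell G) <= e.+1)%N /\ (pencil al x ell G)`_e = G.@[x] *: ell ^+ e.
Proof.
move=> Ge; pose top e (p : {poly {mpoly K[q]}}) b := (size p <= e.+1)%N /\ p`_e = b.
have topM e1 e2 p1 p2 b1 b2 : top e1 p1 b1 -> top e2 p2 b2 -> top (e1 + e2)%N (p1 * p2) (b1 * b2).
  move=> [s1 <-] [s2 <-]; split.
    by apply: leq_trans (size_polyMleq _ _) _; lia.
  rewrite coefM; have e12 : (e1 < (e1 + e2).+1)%N by lia.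
  rewrite (bigD1 (Ordinal e12)) //= addKn big1 ?addr0 // => j.
  rewrite -val_eqE /= neq_ltn => /orP[je|je].
    by rewrite [p2`__]nth_default ?mulr0 //; apply: leq_trans s2 _; lia.
  by rewrite [p1`__]nth_default ?mul0r //; apply: leq_trans s1 _; lia.
pose F i : {poly {mpoly K[q]}} := (al i)%:P + (x i *: ell) *: 'X.
have topF i : top 1%N (F i) (x i *: ell).
  split; last by rewrite coefD coefC coefZ coefX /= mulr1 add0r.
  rewrite (leq_trans (size_polyD _ _)) // geq_max (leq_trans (size_polyC_leq1 _)) //=.
  by rewrite (leq_trans (size_scale_leq _ _)) // size_polyX.
have topX i h : top h (F i ^+ h) ((x i *: ell) ^+ h).
  elim: h => [|h IH]; first by split; rewrite ?expr0 ?size_poly1 // coef1.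
  by rewrite !exprS -[h.+1]add1n; apply: topM.
have term M : M \in msupp G -> top e (((polyC \o @mpolyC q K) G@_M) * mmap1 F M)
    ((G@_M * \prod_i x i ^+ M i) *: ell ^+ e).
  move=> /(homog_mdeg Ge) Me; have eM : e = (\sum_i M i)%N by rewrite -Me mdegE.
  have -> : (G@_M * \prod_i x i ^+ M i) *: ell ^+ e =
      (G@_M)%:MP * \prod_i (x i *: ell) ^+ M i.
    rewrite mul_mpolyC -scalerA eM; congr (_ *: _).
    rewrite (eq_bigr (fun i => x i ^+ M i *: ell ^+ M i)); last by move=> i _; rewrite exprZn.
    by rewrite scaler_prod prodrXr.
  rewrite -[e]add0n; apply: (topM 0%N); first by split; [exact: size_polyC_leq1 | rewrite coefC].
  rewrite /mmap1 eM.
  by apply: (big_rec3 (fun p b e => top e p b)) => [|i p b a _];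
    [split; rewrite ?size_poly1 ?coef1 | exact: topM].
rewrite /pencil -lock /mmap mevalE scaler_suml; split.
  apply: leq_trans (size_sum _ _ _) _; apply/bigmax_leqP_seq => M MG _.
  exact: (term M MG).1.
by rewrite coef_sum !big_seq; apply: eq_bigr => M /term[].
Qed.

End TopCoefficient.

(** * Forms that satisfy a relation *)

Section DropForm.
Variables (K : fieldType) (p q : nat) (w : nat -> nat).
Hypothesis charK0 : [pchar K] =i pred0.
Hypothesis w_gt0 : forall j : 'I_p, (0 < w j)%N.

Definition degree_bound := (\max_(j < p) w j).+1.

Definition form_coord : finType :=
  {t : 'I_p * 'X_{1..q < degree_bound} | mdeg t.2 == w t.1}.

Definition cform (a : 'I_#|form_coord|) : 'I_p := (val (enum_val a)).1.
Definition cmon (a : 'I_#|form_coord|) : 'X_{1..q} := (val (enum_val a)).2.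
Definition coord (V : 'I_p -> {mpoly K[q]}) a : K := (V (cform a))@_(cmon a).

Lemma mdeg_cmon a : mdeg (cmon a) = w (cform a).
Proof. exact/eqP/(valP (enum_val a)). Qed.

Lemma cmon_inj a b : cform a = cform b -> cmon a = cmon b -> a = b.
Proof.
move=> fab mab; apply/enum_val_inj/val_inj.
rewrite [val (enum_val a)]surjective_pairing [val (enum_val b)]surjective_pairing.
by congr (_, _) => //; apply: val_inj.
Qed.

Lemma form_coordP (j : 'I_p) (m : 'X_{1..q}) : mdeg m = w j -> exists a, cform a = j /\ cmon a = m.
Proof.
move=> mj; have mb : (mdeg m < degree_bound)%N.
  by rewrite ltnS mj (leq_bigmax (F := fun j : 'I_p => w j)).
have Ht : mdeg (j, BMultinom mb).2 == w (j, BMultinom mb).1 by rewrite /= mj.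
exists (enum_rank (exist (fun t : 'I_p * 'X_{1..q < degree_bound} =>
  is_true (mdeg t.2 == w t.1)) _ Ht)).
by rewrite /cform /cmon enum_rankK.
Qed.

Lemma xeval_comp n m (G : {mpoly K[n + m]}) (x : 'I_n -> K) :
  xeval G x = G \mPo [tuple vjoin (fun i => (x i)%:MP) (fun b => 'X_b) i | i < n + m].
Proof.
rewrite comp_mpolyEX; apply: eq_bigr => M _; rewrite comp_mpolyX big_split_ord -scalerA.
congr (_ *: _); rewrite -mul_mpolyC; congr (_ * _).
  rewrite rmorph_prod; apply: eq_bigr => i _.
  by rewrite tnth_mktuple vjoinl mnmE rmorphXn.
rewrite mpolyXE_id; apply: eq_bigr => i _.
by rewrite tnth_mktuple vjoinr mnmE.
Qed.

Variables (n : nat) (U : 'I_p -> {mpoly K[n]}).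
Hypothesis U_homog : forall j, U j \is (w j).-homog.

Definition lin_sub (tau : 'I_n -> 'I_q -> K) j : {mpoly K[q]} :=
  U j \mPo [tuple linform (tau i) | i < n].

Let Van (f : {mpoly K[#|form_coord|]}) := forall tau, f.@[coord (lin_sub tau)] = 0.

Lemma linformD_scale tau (s : K) (x : 'I_n -> K) (c : 'I_q -> K) j :
  U j \mPo [tuple linform (tau i) + (s * x i) *: linform c | i < n] =
  lin_sub (fun i b => tau i b + s * x i * c b) j.
Proof.
congr (_ \mPo _); apply: eq_mktuple => i; rewrite /linform scaler_sumr -big_split.
by apply: eq_bigr => b _; rewrite scalerDl scalerA.
Qed.

Section Direction.
Variables (tau : 'I_n -> 'I_q -> K) (c : 'I_q -> K).

(** The forms [U] are expanded at [tau(y) + c(y) x], with [x] in the original variables and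
    [y] in [q] new ones. The coefficients of the monomials in [y] are polynomials in
    [x]; their homogeneous components are the forms of lower degree. *)
Definition expansion j : {mpoly K[n + q]} :=
  U j \mPo [tuple \sum_b tau i b *: 'X_(rshift n b) +
                  'X_(lshift q i) * \sum_b c b *: 'X_(rshift n b) | i < n].

Definition mixed a := xcoef (expansion (cform a)) (cmon a).
Definition lowform a i := pihomog mdeg i (mixed a).

Lemma meval_mixed a x :
  (mixed a).@[x] = (lin_sub (fun i b => tau i b + x i * c b) (cform a))@_(cmon a).
Proof.
rewrite /mixed -mcoeff_xeval xeval_comp /expansion comp_mpoly_comp; congr (_ \mPo _)@__.
apply: eq_mktuple => i; rewrite comp_mpolyD comp_mpolyM !raddf_sum /=.
rewrite comp_mpolyXU -tnth_nth tnth_mktuple vjoinl /linform mul_mpolyC scaler_sumr -big_split.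
apply: eq_bigr => b _ /=.
by rewrite !comp_mpolyZ comp_mpolyXU -tnth_nth tnth_mktuple vjoinr scalerA scalerDl.
Qed.

Let bound := (\max_a msize (mixed a))%N.

Lemma lowform_bound a i : (bound <= i)%N -> lowform a i = 0.
Proof.
move=> bi; apply/mpolyP => M; rewrite mcoeff_pihomog mcoeff0; case: eqP => // Mi.
apply: memN_msupp_eq0; apply: msize_mdeg_ge; apply: leq_trans (leq_trans _ bi) _.
  by rewrite /bound; apply: (leq_bigmax (F := fun a => msize (mixed a)) a).
by rewrite -Mi.
Qed.

Definition lowpoly a : {poly {mpoly K[n]}} := \poly_(i < bound) lowform a i.

Lemma coef_lowpoly a i : (lowpoly a)`_i = lowform a i.
Proof. by rewrite coef_poly; case: ltnP => // bi; rewrite lowform_bound. Qed.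

Lemma lowpoly_eval a s x : ((lowpoly a).[s%:MP]).@[x] = (mixed a).@[fun i => s * x i].
Proof.
rewrite horner_poly raddf_sum [in RHS](pihomog_partitionE (k := bound) (mf := mdeg) (p := mixed a)).
  rewrite raddf_sum; apply: eq_bigr => i _ /=.
  rewrite (meval_homogZ _ _ (pihomogP _ _ _)) mevalM -rmorphXn /= mevalC mulrC //.
by apply: (leq_bigmax (F := fun a => msize (mixed a)) a).
Qed.

Lemma lowform_pencil a i x : (lowform a i).@[x] =
  ((pencil (fun i => linform (tau i)) x (linform c) (U (cform a)))`_i)@_(cmon a).
Proof.
set Pi := pencil _ _ _ _.
pose f : {poly K} := map_poly (meval x) (lowpoly a).
pose g : {poly K} := \poly_(i < size Pi) (Pi`_i)@_(cmon a).
have gE j : g`_j = (Pi`_j)@_(cmon a).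
  by rewrite coef_poly; case: ltnP => // sj; rewrite nth_default // mcoeff0.
have fE j : f`_j = (lowform a j).@[x] by rewrite coef_map coef_lowpoly.
suff fg : f = g by rewrite -fE fg gE.
apply/eqP; rewrite -subr_eq0; apply/eqP; apply: (poly_vanish charK0) => s.
rewrite hornerD hornerN -{1}[s](mevalC x) horner_map /= lowpoly_eval meval_mixed.
have -> : g.[s] = (Pi.[s%:MP])@_(cmon a).
  rewrite horner_poly horner_coef raddf_sum; apply: eq_bigr => j _ /=.
  by rewrite -rmorphXn /= [in RHS]mulrC mcoeffCM mulrC.
by rewrite pencil_eval linformD_scale subrr.
Qed.

Lemma lowform_homog a i : lowform a i \is i.-homog.
Proof. exact: pihomogP. Qed.

Lemma meval_eq_mpoly (f g : {mpoly K[n]}) : (forall x, f.@[x] = g.@[x]) -> f = g.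
Proof.
move=> fg; apply/eqP; rewrite -subr_eq0; apply/eqP; apply: (mpoly_vanish charK0) => x.
by rewrite mevalB fg subrr.
Qed.

Lemma lowform0 a : lowform a 0 = (coord (lin_sub tau) a)%:MP.
Proof.
apply: meval_eq_mpoly => x; rewrite lowform_pencil mevalC /coord -horner_coef0.
rewrite -mpolyC0 pencil_eval linformD_scale; congr (_@__); congr lin_sub.
by apply: funext => i; apply: funext => b; rewrite !mul0r addr0.
Qed.

Lemma lowform_top a :
  lowform a (w (cform a)) = (linform c ^+ w (cform a))@_(cmon a) *: U (cform a).
Proof.
apply: meval_eq_mpoly => x; rewrite lowform_pencil mevalZ.
by rewrite (pencil_top _ _ _ (U_homog _)).2 mcoeffZ mulrC.
Qed.

Lemma lowform_high a i : (w (cform a) < i)%N -> lowform a i = 0.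
Proof.
move=> wi; apply: meval_eq_mpoly => x; rewrite lowform_pencil meval0 nth_default ?mcoeff0 //.
exact: leq_trans (pencil_top _ _ _ (U_homog _)).1 wi.
Qed.

Lemma peval_vanish f : Van f -> peval lowpoly f = 0.
Proof.
move=> Vf; apply/polyP => i; rewrite coef0; apply: (mpoly_vanish charK0) => x.
pose g : {poly K} := map_poly (meval x) (peval lowpoly f).
suff g0 : g = 0 by have := congr1 (fun h : {poly K} => h`_i) g0; rewrite coef_map coef0.
apply: (poly_vanish charK0) => s; rewrite -[s](mevalC x) horner_map /= peval_eval -[RHS](Vf
  (fun i b => tau i b + s * x i * c b)).
by apply: meval_eq => a; rewrite lowpoly_eval meval_mixed.
Qed.

End Direction.

Lemma minimal_relation f : f != 0 -> Van f -> exists g, [/\ g != 0, Van g &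
  forall h, h != 0 -> Van h -> (msize g <= msize h)%N].
Proof.
move=> f0 Vf; pose Q m := `[< exists g, [/\ g != 0, Van g & msize g = m] >].
have exQ : exists m, Q m by exists (msize f); apply/asboolP; exists f.
have [m /asboolP[g [g0 Vg gm]] mmin] := ex_minnP exQ.
by exists g; split=> // h h0 Vh; rewrite gm; apply: mmin; apply/asboolP; exists h.
Qed.

(** Take a relation [g] of least degree and, among the coordinates on which it depends, one
    belonging to a form [U j0] of the largest degree [k]. Expanding [g] at
    [tau(y) + c(y) x], the component of degree [k] in [x] vanishes; to first order it is
    the combination of the components of degree [k] of the coordinates with the partial
    derivatives of [g] at [tau] as coefficients. These components are multiples of the
    forms of degree [k], by coefficients of the [k]-th power of the linear form [c], and
    [U j0] gets the coefficient [D] at [tau], where [D] is a combination of partial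
    derivatives of [g]. Powers of linear forms span, so [D] is nonzero for some [c]; its
    degree is less than that of [g], so by minimality it does not vanish at some [tau]. *)
Theorem drop_dependent_form f : f != 0 -> Van f ->
  exists (j0 : 'I_p) (low : 'I_#|form_coord| -> nat -> {mpoly K[n]}),
    (forall a i, low a i \is i.-homog) /\
    generated ([set U j | j in [set j | j != j0]] `|`
       [set F | exists a i, (0 < i < w j0)%N /\ F = low a i]) (U j0).
Proof.
move=> f0 /(minimal_relation f0)[g [g0 Vg gmin]].
have [a1 da1] : exists a, g^`M(a) != 0.
  apply: (mderiv_neq0 charK0) => b gb; case/eqP: g0; have := Vg (fun _ _ => 0).
  by rewrite gb mevalC => ->; apply: mpolyC0.
have [a0 da0 amax] := @arg_maxnP _ a1 (fun a => g^`M(a) != 0) (fun a => w (cform a)) da1.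
pose j0 := cform a0; pose k := w j0.
have [c [D [D0 Dsize DE]]] : exists c (D : {mpoly K[#|form_coord|]}),
    [/\ D != 0, (msize D < msize g)%N &
        forall x, D.@[x] = \sum_(a | cform a == j0) (linform c ^+ k)@_(cmon a) * (g^`M(a)).@[x]].
  have exN a : exists N, (0 < N)%N /\ forall c,
      (linform c ^+ w (cform a))@_(cmon a) = N%:R * \prod_b c b ^+ cmon a b :> K.
    by have [N N0 NE] := linform_power K (mdeg_cmon a); exists N.
  have [N NP] := choice exN.
  (* a fixed monomial mu of the derivatives turns D into a polynomial function R of c *)
  pose mu := mlead (g^`M(a0)).
  pose R := \sum_(a | cform a == j0) ((N a)%:R * (g^`M(a))@_mu) *: 'X_[cmon a].
  have Ra0 : R@_(cmon a0) != 0.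
    rewrite /R (raddf_sum (mcoeff _)) (bigD1 a0) //= mcoeffZ mcoeffX eqxx mulr1.
    rewrite big1 => [|a /andP[/eqP aj aa0]].
      by rewrite addr0 mulf_neq0 // ?mleadc_eq0 // natr_neq0 // (NP a0).1.
    rewrite mcoeffZ mcoeffX; case: eqP => [mm|]; rewrite ?mulr0 //.
    by case/eqP: aa0; apply: cmon_inj.
  have [c Rc] : exists c, R.@[c] != 0.
    apply: contrapT => nc; move: Ra0; rewrite (mpoly_vanish charK0 (p := R)) ?mcoeff0 ?eqxx // => c.
    by apply: contrapT => /eqP Rc; apply: nc; exists c.
  exists c, (\sum_(a | cform a == j0) (linform c ^+ k)@_(cmon a) *: g^`M(a)); split.
  - apply: contraNneq Rc => D0; apply/eqP; rewrite -(mcoeff0 K mu) -D0.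
    rewrite (raddf_sum (meval c)) (raddf_sum (mcoeff mu)).
    apply: eq_bigr => a /eqP aj; rewrite /= mcoeffZ mevalZ mevalX /k -aj (NP a).2.
    by rewrite mulrAC.
  - rewrite -(prednK (_ : 0 < msize g)%N) ?lt0n ?msize_poly_eq0 // ltnS.
    apply: msize_leP => M; rewrite mcoeff_msupp => DM.
    have [a da] : exists a, (g^`M(a))@_M != 0.
      apply: contrapT => na; case/eqP: DM; rewrite (raddf_sum (mcoeff M)) big1 // => a _ /=.
      rewrite mcoeffZ; apply/eqP; rewrite mulf_eq0; apply/orP; right.
      by apply: contrapT => da; apply: na; exists a; apply/negP.
    have Mg : (mdeg M < msize (g^`M(a)))%N by apply: msize_mdeg_lt; rewrite mcoeff_msupp.
    by have := msize_deriv a g0; lia.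
  - by move=> x; rewrite (raddf_sum (meval x)); apply: eq_bigr => a _; rewrite /= mevalZ.
have [tau Dtau] : exists tau, D.@[coord (lin_sub tau)] != 0.
  apply: contrapT => nt; suff VD : Van D by have := gmin D D0 VD; rewrite leqNgt Dsize.
  by move=> tau; apply: contrapT => /eqP Dt; apply: nt; exists tau.
exists j0, (lowform tau c); split; first by move=> a i; apply: lowform_homog.
set gen := (X in generated X).
have low0 a : (lowpoly tau c a)`_0 = (coord (lin_sub tau) a)%:MP.
  by rewrite coef_lowpoly lowform0.
have low_gen a i : (0 < i < k)%N -> generated gen (lowpoly tau c a)`_i.
  by move=> ik; rewrite coef_lowpoly; apply: generated_gen; right; exists a, i.
have [_ _] := peval_taylor (w_gt0 j0) low0 low_gen g.
rewrite peval_vanish // coef0 sub0r => /(generatedZ (-1)); rewrite scaleN1r opprK.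
rewrite (bigID (fun a => cform a == j0)) /= => genS.
have others : generated gen (\sum_(a | cform a != j0)
    (g^`M(a)).@[coord (lin_sub tau)] *: (lowpoly tau c a)`_k).
  apply: generated_sum => a aj0; rewrite coef_lowpoly.
  have [da|/amax wle] := eqVneq (g^`M(a)) 0; first by rewrite da meval0 scale0r; apply: generated0.
  have : (w (cform a) <= k)%N by []; rewrite leq_eqVlt => /predU1P[wk|wk]; last first.
    by rewrite lowform_high // scaler0; apply: generated0.
  rewrite -wk lowform_top; do 2!apply: generatedZ.
  by apply: generated_gen; left; exists (cform a).
have := generatedD genS (generatedZ (-1) others); rewrite scaleN1r addrK.
rewrite (eq_bigr (fun a => ((linform c ^+ k)@_(cmon a) * (g^`M(a)).@[coord (lin_sub tau)]) *: U j0)).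
  rewrite -scaler_suml -DE => /(generatedZ (D.@[coord (lin_sub tau)])^-1).
  by rewrite scalerA mulVf // scale1r.
by move=> a /eqP aj0; rewrite coef_lowpoly /k -aj0 lowform_top scalerA mulrC.
Qed.

End DropForm.

(** * Bounding the number of forms *)

Section RowCoordinates.
Variables (K : fieldType) (N : nat).

Definition entry (a : 'I_N) (x : 'rV[K]_N) : K := x ord0 a.

Fact entry_is_scalar a : scalar (entry a).
Proof. by move=> k u v; rewrite /entry !mxE. Qed.

HB.instance Definition _ a := GRing.isLinear.Build K 'rV[K]_N K *%R (entry a) (entry_is_scalar a).

Lemma polynomial_fun_rV (f : 'rV[K]_N -> K) : polynomial_fun f ->
  exists g : {mpoly K[N]}, forall x, f x = g.@[fun a => x ord0 a].
Proof.
case=> k [l [p fE]]; exists (p \mPo [tuple linform (fun a => l i (delta_mx ord0 a)) | i < k]) => x.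
rewrite fE comp_mpoly_meval; apply: meval_eq => i; rewrite tnth_mktuple /linform.
rewrite {1}(row_sum_delta x) !raddf_sum; apply: eq_bigr => a _ /=.
by rewrite linearZ mevalZ mevalXU mulrC.
Qed.

End RowCoordinates.

(** Tuples [c 1, ..., c d] are compared from the last index on; the entries before the
    first difference may grow. *)
Lemma lexicographic_ind (d : nat) (Good : (nat -> nat) -> Prop) :
  (forall c, (forall c', (exists k, [/\ (0 < k <= d)%N, (c' k < c k)%N &
      forall a, (k < a <= d)%N -> c' a = c a]) -> Good c') -> Good c) ->
  forall c, Good c.
Proof.
move=> step; suff H k : (k <= d)%N -> forall c, (forall c', (exists j, [/\ (k < j <= d)%N,
    (c' j < c j)%N & forall a, (j < a <= d)%N -> c' a = c a]) -> Good c') -> Good c.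
  by move=> c; apply: (H d) => // c' [j [jd _ _]]; lia.
elim: k => [_|k IH kd] c Hc; first by apply: step => c'; apply: Hc.
move: {2}(c k.+1) (erefl (c k.+1)) => v; elim/ltn_ind: v c Hc => v IHv c Hc cv.
apply: IH => [|c' [j [/andP[kj jd] jc ja]]]; first exact: ltnW.
have [kj'|] := ltnP k.+1 j; first by apply: Hc; exists j; rewrite kj'.
move=> jk; have jE : j = k.+1 by apply/eqP; rewrite eqn_leq jk kj.
rewrite {j jk kj}jE in jd jc ja; apply: (IHv (c' k.+1)) => //; first by rewrite -cv.
move=> c'' [j [jd' jc' ja']]; apply: Hc; exists j; split=> // [|a ad].
  by rewrite -ja.
by rewrite ja' // ja //; lia.
Qed.

Section Reduction.
Variables (K : closedFieldType) (d r : nat) (e : 'I_r -> nat).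
Hypothesis charK0 : [pchar K] =i pred0.
Hypothesis e_bnd : forall i, (1 <= e i <= d - 1)%N.
Hypothesis d_gt0 : (0 < d)%N.

(** With these weights, [d * M] variables offer [M] of each weight from [1] to [d]. *)
Definition cyclic_weight (j : nat) := (j %% d).+1.

Definition parametrized M n (F : {mpoly K[n]}) := exists P (V : 'I_(d * M) -> {mpoly K[n]}),
  [/\ wborder d e cyclic_weight P, forall j, V j \is (cyclic_weight j).-homog &
      F = P \mPo [tuple V j | j < d * M]].

Lemma parametrized_mono M M' n (F : {mpoly K[n]}) : (M <= M')%N ->
  parametrized M F -> parametrized M' F.
Proof.
move=> MM [P [V [PX Vh ->]]]; have dM : (d * M <= d * M')%N by rewrite leq_mul2l MM orbT.
exists (P \mPo [tuple 'X_(widen_ord dM j) | j < d * M]), (fun j => oapp V 0 (insub (j : nat))).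
split.
- by apply: wborder_comp PX => j; apply: var_homog.
- by move=> j; case: insubP => [j' _ jE|_] /=; [rewrite -jE | apply: dhomog0].
- rewrite comp_mpoly_comp; congr (_ \mPo _); apply: eq_mktuple => j.
  by rewrite comp_mpolyXU -tnth_nth tnth_mktuple /= valK.
Qed.

Definition gens c n (U : nat -> nat -> {mpoly K[n]}) :=
  [set F | exists a i, [/\ (0 < a <= d)%N, (i < c a)%N & F = U a i]].

(** The bound [M] depends on the number [c a] of forms of each degree [a] only, neither
    on the forms nor on the number of their variables. *)
Definition reducible c := exists M, forall n (F : {mpoly K[n]}) (U : nat -> nat -> {mpoly K[n]}),
  (forall b i, U b i \is b.-homog) -> wborder d e (fun=> 1%N) F ->
  generated (gens c U) F -> parametrized M F.

Section Step.
Variable c : nat -> nat.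

Definition slots : seq (nat * nat) := [seq (a, i) | a <- iota 1 d, i <- iota 0 (c a)].
Definition slot j := nth (1%N, 0%N) slots j.

Lemma slot_bound j : (j < size slots)%N -> (0 < (slot j).1 <= d)%N /\ ((slot j).2 < c (slot j).1)%N.
Proof.
move=> /(mem_nth (1%N, 0%N)); rewrite -/(slot j) => /allpairsPdep[a [i [ad ic ->]]] /=.
by move: ad ic; rewrite !mem_iota; lia.
Qed.

Lemma slot_index a i : (0 < a <= d)%N -> (i < c a)%N ->
  exists2 j, (j < size slots)%N & slot j = (a, i).
Proof.
move=> ad ic; have ai : (a, i) \in slots.
  by apply/allpairsPdep; exists a, i; rewrite !mem_iota; split=> //; lia.
by exists (index (a, i) slots); rewrite ?index_mem // /slot nth_index.
Qed.

Lemma slot_inj i j : (i < size slots)%N -> (j < size slots)%N -> slot i = slot j -> i = j.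
Proof.
move=> il jl /eqP; rewrite nth_uniq // => [/eqP //|].
apply: allpairs_uniq_dep; first exact: iota_uniq.
- by move=> a _; apply: iota_uniq.
- by move=> [a1 i1] [a2 i2] _ _ /= [-> ->].
Qed.

Let p := size slots.
Let w j := (slot j).1.
Let slot_form n (U : nat -> nat -> {mpoly K[n]}) (j : 'I_p) := U (slot j).1 (slot j).2.

Lemma gens_range n (U : nat -> nat -> {mpoly K[n]}) : gens c U = range (slot_form U).
Proof.
apply/seteqP; split=> F.
  move=> [a [i [ad ic ->]]]; have [j jp sj] := slot_index ad ic.
  by exists (Ordinal jp) => //; rewrite /slot_form /= sj.
move=> [j _ <-]; have [ad ic] := slot_bound (ltn_ord j).
by exists (slot j).1, (slot j).2.
Qed.

Lemma w_gt0 (j : 'I_p) : (0 < w j)%N.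
Proof. by have [/andP[]] := slot_bound (ltn_ord j). Qed.

(** Write [F] as a polynomial [P] in the forms, and substitute for the latter the
    forms [v] of [weights_detect]. If [P] is not in the closure, an equation [E] of the closure
    does not vanish at the result. Then [E (P \mPo V)], as a function of the coefficients of a
    tuple [V] of forms, is not zero, but it vanishes at the given forms after any linear
    substitution, since [F] is in the closure: the forms satisfy a relation. *)
Lemma reduction_dichotomy : exists q, forall n (F : {mpoly K[n]}) (U : nat -> nat -> {mpoly K[n]}),
  (forall b i, U b i \is b.-homog) -> wborder d e (fun=> 1%N) F ->
  generated (gens c U) F ->
  (exists2 P, wborder d e w P & F = P \mPo [tuple slot_form U j | j < p]) \/
  exists (j0 : 'I_p) (low : 'I_#|form_coord p q w| -> nat -> {mpoly K[n]}),
    (forall a i, low a i \is i.-homog) /\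
    generated ([set slot_form U j | j in [set j | j != j0]] `|`
       [set F | exists a i, (0 < i < w j0)%N /\ F = low a i]) (slot_form U j0).
Proof.
have [|q [v [vh vP]]] := @weights_detect K d r e charK0 e_bnd p w.
  by move=> i ip; have := w_gt0 (Ordinal ip).
exists q => n F U Uh FX; rewrite gens_range => /generated_comp[P FE].
have [PX|nPX] := pselect (wborder d e w P); [by left; exists P | right].
have [E [pE EX Ev]] : exists E, [/\ polynomial_fun E,
    forall G, wstrength d e (fun=> 1%N) G -> E G = 0 & E (P \mPo [tuple v j | j < p]) != 0].
  apply: contrapT => nE; apply: nPX; apply: vP; apply/zariski_closureP => E pE EX.
  by apply: contrapT => /eqP Ev; apply: nE; exists E.
set N := #|form_coord p q w|.
pose VV (x : 'rV[K]_N) (j : 'I_p) : {mpoly K[q]} :=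
  \sum_(a | cform a == j) entry a x *: 'X_[cmon a].
have [f fE] : exists f : {mpoly K[N]}, forall x,
    E (P \mPo [tuple VV x j | j < p]) = f.@[fun a => x ord0 a].
  apply: polynomial_fun_rV; apply: polynomial_fun_comp pE _.
  apply: polynomial_map_comp_mpoly (polynomial_map_cst _ _) _ => j.
  apply: polynomial_map_sum => a _; apply: PolynomialMapTerm.
  exact: polynomial_fun_scalar.
have fV (V : 'I_p -> {mpoly K[q]}) : (forall j, V j \is (w j).-homog) ->
    E (P \mPo [tuple V j | j < p]) = f.@[coord V].
  move=> Vh; rewrite (@meval_eq _ _ _ (fun a => (\row_a coord V a) ord0 a)); last first.
    by move=> a; rewrite mxE.
  rewrite -fE; congr (E (_ \mPo _)); apply: eq_mktuple => j.
  rewrite /VV; apply/mpolyP => M; rewrite raddf_sum /=.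
  have [Mw|Mw] := eqVneq (mdeg M) (w j).
    have [a [aj aM]] := form_coordP Mw.
    rewrite (bigD1 a) /= ?aj ?eqxx // mcoeffZ mcoeffX aM eqxx mulr1 /entry mxE /coord aj aM.
    rewrite big1 ?addr0 // => b /andP[/eqP bj ba]; rewrite mcoeffZ mcoeffX.
    case: eqP => [bM|]; rewrite ?mulr0 //; case/eqP: ba; apply: cmon_inj; first by rewrite bj aj.
    by rewrite bM aM.
  rewrite (dhomog_nemf_coeff (Vh j) Mw) big1 // => b /eqP bj; rewrite mcoeffZ mcoeffX.
  by case: eqP => [bM|]; rewrite ?mulr0 //; case/eqP: Mw; rewrite -bM mdeg_cmon bj.
have formh j : slot_form U j \is (w j).-homog by apply: Uh.
apply: (drop_dependent_form charK0 w_gt0 formh (f := f)).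
  by apply: contraNneq Ev => f0; rewrite fV // f0 meval0.
move=> tau; have linh (i : 'I_n) : linform (tau i) \is 1%N.-homog.
  by apply: rpred_sum => b _; apply: rpredZ; rewrite dhomogX; apply/eqP/mdeg1.
rewrite -fV; last first.
  move=> j; apply: (@comp_homog K (fun=> 1%N)) linh.
  by rewrite wdeg1_homog.
rewrite -comp_mpoly_comp -FE; apply: (zariski_closureP _ _).1 EX => //.
by apply: wborder_comp FX => i; rewrite wdeg1_homog.
Qed.

Definition lower_counts N k a :=
  if (a < k)%N then (c a + N)%N else if a == k then (c k).-1 else c a.

(** The dropped form gives its index to the last form of its degree; the forms that
    replace it are appended in the lower degrees. *)
Lemma gens_lower n (U : nat -> nat -> {mpoly K[n]}) N (j0 : 'I_p)
    (low : 'I_N -> nat -> {mpoly K[n]}) :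
  (forall b i, U b i \is b.-homog) -> (forall a i, low a i \is i.-homog) ->
  generated ([set slot_form U j | j in [set j | j != j0]] `|`
     [set F | exists a i, (0 < i < w j0)%N /\ F = low a i]) (slot_form U j0) ->
  exists2 U' : nat -> nat -> {mpoly K[n]}, (forall b i, U' b i \is b.-homog) &
    generated (gens c U) `<=` generated (gens (lower_counts N (w j0)) U').
Proof.
move=> Uh lowh; set k := w j0; set i0 := (slot j0).2 => genj0.
have [kd i0c] : (0 < k <= d)%N /\ (i0 < c k)%N := slot_bound (ltn_ord j0).
pose U' a i := if (a < k)%N then (if (i < c a)%N then U a i
    else oapp (fun t => low t a) 0 (insub (i - c a)%N))
  else if (a == k) && (i == i0) then U k (c k).-1 else U a i.
exists U' => [a i|].
  rewrite /U'; case: ifP => _; first case: ifP => // _.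
    by case: insubP => [t _ _|_] /=; [apply: lowh | apply: dhomog0].
  by case: ifP => // /andP[/eqP -> _].
have old a i : (0 < a <= d)%N -> (i < c a)%N -> (a, i) != (k, i0) ->
    gens (lower_counts N k) U' (U a i).
  move=> ad ic ai; have [ak|ak] := ltnP a k.
    by exists a, i; rewrite /lower_counts /U' ak ic; split=> //; rewrite ltn_addr.
  have [aE|ank] := eqVneq a k; last first.
    by exists a, i; rewrite /lower_counts /U' (ltnNge a k) ak /= (negbTE ank).
  rewrite aE in ad ic ai *; have ii : i != i0 by apply: contraNneq ai => ->.
  have [il|il] := ltnP i (c k).-1.
    by exists k, i; rewrite /lower_counts /U' (ltnn k) eqxx (negbTE ii).
  exists k, i0; rewrite /lower_counts /U' (ltnn k) !eqxx; split=> //; first by lia.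
  by congr (U k _); lia.
apply: generated_sub => _ [a [i [ad ic ->]]].
have [[-> ->]|ai] := eqVneq (a, i) (k, i0); last by apply: generated_gen; apply: old.
apply: generated_sub genj0 => _ [[j jj0 <-]|[t [b [bk ->]]]]; apply: generated_gen.
  have [sj sc] := slot_bound (ltn_ord j); apply: old => //.
  apply: contraNneq jj0 => E; apply/eqP/val_inj; apply: slot_inj => /=; rewrite ?ltn_ord //.
  by rewrite [slot j]surjective_pairing E [RHS]surjective_pairing.
case/andP: bk => b0; rewrite -/k => bk.
exists b, (c b + t)%N; rewrite /lower_counts /U' bk; split.
- by rewrite b0; move: kd bk; lia.
- by rewrite ltn_add2l.
- by rewrite (ltnNge (c b + t)) leq_addr /= addKn valK.
Qed.

Lemma reducible_step : (forall c', (exists k, [/\ (0 < k <= d)%N, (c' k < c k)%N &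
      forall a, (k < a <= d)%N -> c' a = c a]) -> reducible c') -> reducible c.
Proof.
move=> IH; have [q dich] := reduction_dichotomy.
set N := #|form_coord p q w| in dich.
have exM k : exists M, (0 < k <= d)%N -> (0 < c k)%N ->
    forall n (F : {mpoly K[n]}) (U : nat -> nat -> {mpoly K[n]}),
    (forall b i, U b i \is b.-homog) -> wborder d e (fun=> 1%N) F ->
    generated (gens (lower_counts N k) U) F -> parametrized M F.
  have [kd|] := boolP (0 < k <= d)%N; last by exists 0%N.
  have [ck|] := ltnP 0 (c k); last by exists 0%N.
  have [|M HM] := IH (lower_counts N k); last by exists M => _ _; apply: HM.
  exists k; rewrite /lower_counts ltnn eqxx prednK //; split=> // a /andP[ka _].
  by rewrite ltnNge (ltnW ka) /= gtn_eqF.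
have [Mk MkP] := choice exM.
pose M0 := (\max_(a < d.+1) c a)%N; pose M1 := (\max_(k < d.+1) Mk k)%N.
exists (maxn M0 M1) => n F U Uh FX FU.
have [[P PX ->]|[j0 [low [lowh genj0]]]] := dich n F U Uh FX FU; last first.
  have [U' U'h sub] := gens_lower Uh lowh genj0.
  have [kd i0c] : (0 < w j0 <= d)%N /\ ((slot j0).2 < c (w j0))%N := slot_bound (ltn_ord j0).
  apply: (@parametrized_mono (Mk (w j0))).
    rewrite leq_max; apply/orP; right; case/andP: kd => _; rewrite -ltnS => kd.
    exact: (leq_bigmax (F := fun k : 'I_d.+1 => Mk k) (Ordinal kd)).
  by apply: (MkP (w j0) kd _ _ _ U') => //; [apply: leq_ltn_trans i0c | apply: sub].
apply: (@parametrized_mono M0); first exact: leq_maxl.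
have idx (j : 'I_p) : ((slot j).1.-1 + (slot j).2 * d < d * M0)%N.
  have [/andP[a0 ad] ic] := slot_bound (ltn_ord j).
  have iM : ((slot j).2 < M0)%N.
    apply: leq_trans ic _; rewrite -ltnS in ad.
    exact: (leq_bigmax (F := fun k : 'I_d.+1 => c k) (Ordinal ad)).
  apply: (@leq_trans ((slot j).2.+1 * d)%N); last by rewrite mulnC leq_mul2l iM orbT.
  by rewrite mulSn ltn_add2r prednK.
have wt (j : 'I_p) : cyclic_weight ((slot j).1.-1 + (slot j).2 * d)%N = w j.
  have [/andP[a0 ad] _] := slot_bound (ltn_ord j).
  by rewrite /cyclic_weight addnC modnMDl modn_small ?prednK.
exists (P \mPo [tuple 'X_(Ordinal (idx j)) | j < p]).
exists (fun j => U (cyclic_weight j) (j %/ d)%N); split.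
- by apply: wborder_comp PX => j; apply: var_homog => /=.
- by move=> j; apply: Uh.
- rewrite comp_mpoly_comp; congr (_ \mPo _); apply: eq_mktuple => j.
  rewrite comp_mpolyXU -tnth_nth tnth_mktuple /= wt /slot_form.
  have [/andP[a0 ad] _] := slot_bound (ltn_ord j).
  by rewrite addnC divnMDl // divn_small ?prednK // addn0.
Qed.

End Step.

(** The reduction starts from the single form [F], a polynomial in itself. *)
Theorem border_parametrized : exists M, forall n (F : {mpoly K[n]}),
  F \is d.-homog -> wborder d e (fun=> 1%N) F -> parametrized M F.
Proof.
have [M MP] : reducible (fun a => (a == d) : nat).
  exact: (lexicographic_ind reducible_step).
exists M => n F Fh FX; apply: (MP n F (fun a i => if a == d then F else 0)) => //.
  by move=> a i; case: eqP => [->|_] //; apply: dhomog0.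
by apply: generated_gen; exists d, 0%N; rewrite eqxx d_gt0 leqnn.
Qed.

End Reduction.

(** * The parametrizing variety *)

Section Irreducibility.
Variables (K : closedFieldType) (W : lmodType K).
Hypothesis charK0 : [pchar K] =i pred0.

Lemma irreducible_zariski_closure (X : set W) : irreducible_set X ->
  irreducible_set (zariski_closure X).
Proof.
case=> [[x Xx] irr]; split; first by exists x; apply: subset_zariski_closure.
have sub Y : zariski_closed Y -> X `<=` Y -> zariski_closure X `<=` Y.
  by move=> Yc XY y; apply.
move=> Y Z Yc Zc /(subset_trans (@subset_zariski_closure K W X))/(irr _ _ Yc Zc).
by case=> [/(sub _ Yc)|/(sub _ Zc)]; [left | right].
Qed.

(** Along a curve parametrized by the line, a product of two polynomial functions
    that vanishes has a factor that vanishes. *)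
Lemma irreducible_by_curves (X : set W) : X !=set0 ->
  (forall x y, X x -> X y -> exists2 C : 'rV[K]_1 -> W, polynomial_map C &
     [/\ C 0 = x, C (const_mx 1) = y & forall t, X (C t)]) ->
  irreducible_set X.
Proof.
move=> X0 curves; split=> // Y Z [FY [FYpol ->]] [FZ [FZpol ->]] XYZ.
apply: contrapT => /not_orP[nY nZ].
have witness (F : set (W -> K)) : ~ X `<=` [set w | forall f, F f -> f w = 0] ->
    exists x f, [/\ X x, F f & f x != 0].
  move=> nF; apply: contrapT => nex; apply: nF => x Xx f Ff.
  by apply: contrapT => /eqP fx; apply: nex; exists x, f.
have [x [f [Xx Ff fx]]] := witness _ nY; have [y [g [Xy Fg gy]]] := witness _ nZ.
have [C pC [C0 C1 CX]] := curves x y Xx Xy.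
have [f' fE] := polynomial_fun_rV (polynomial_fun_comp (FYpol _ Ff) pC).
have [g' gE] := polynomial_fun_rV (polynomial_fun_comp (FZpol _ Fg) pC).
have /eqP : f' * g' = 0.
  apply: (mpoly_vanish charK0) => t; rewrite mevalM.
  have tE h : h.@[t] = h.@[fun a => (\row_a t a) ord0 a].
    by apply: meval_eq => a; rewrite mxE.
  rewrite !tE -fE -gE.
  by case: (XYZ _ (CX (\row_a t a))) => H; [rewrite (H _ Ff) mul0r | rewrite (H _ Fg) mulr0].
rewrite mulf_eq0 => /orP[/eqP f0|/eqP g0].
  by case/eqP: fx; rewrite -C0 fE f0 meval0.
by case/eqP: gy; rewrite -C1 gE g0 meval0.
Qed.

End Irreducibility.

Section Coefficients.
Variables (K : fieldType) (n D : nat).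

Definition mon (a : 'I_#|{: bmultinom n D}|) : 'X_{1..n} := bmnm (enum_val a).

Definition coef_row (P : {mpoly K[n]}) : 'rV[K]_#|{: bmultinom n D}| :=
  \row_a P@_(mon a).

Definition poly_of_row (x : 'rV[K]_#|{: bmultinom n D}|) : {mpoly K[n]} :=
  \sum_a entry a x *: 'X_[mon a].

Fact coef_row_is_linear : linear coef_row.
Proof. by move=> k P Q; apply/rowP => a; rewrite !mxE mcoeffD mcoeffZ. Qed.

HB.instance Definition _ := GRing.isLinear.Build K _ _ _ coef_row coef_row_is_linear.

Fact poly_of_row_is_linear : linear poly_of_row.
Proof.
move=> k x y; rewrite scaler_sumr -big_split; apply: eq_bigr => a _ /=.
by rewrite linearP /= scalerDl scalerA.
Qed.

HB.instance Definition _ := GRing.isLinear.Build K _ _ _ poly_of_row poly_of_row_is_linear.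

Lemma coef_rowK (P : {mpoly K[n]}) : (forall m, (D <= mdeg m)%N -> P@_m = 0) ->
  poly_of_row (coef_row P) = P.
Proof.
move=> PD; apply/mpolyP => M; rewrite raddf_sum /=.
have [DM|MD] := leqP D (mdeg M).
  rewrite PD // big1 // => a _; rewrite mcoeffZ mcoeffX; case: eqP => [aM|]; last by rewrite mulr0.
  by have := bmdeg (enum_val a); rewrite -/(mon a) aM ltnNge DM.
rewrite (bigD1 (enum_rank (BMultinom MD))) //= big1 => [|a aM]; rewrite mcoeffZ mcoeffX.
  by rewrite /entry mxE /mon enum_rankK eqxx mulr1 addr0.
case: eqP => [aE|]; last by rewrite mulr0.
by case/eqP: aM; apply/enum_val_inj/val_inj; rewrite enum_rankK.
Qed.

End Coefficients.

Section Parametrization.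
Variables (K : closedFieldType) (d r : nat) (e : 'I_r -> nat) (w : nat -> nat) (p : nat).
Hypothesis charK0 : [pchar K] =i pred0.
Hypothesis e_bnd : forall i, (1 <= e i <= d - 1)%N.
Hypothesis w_gt0 : forall i, (0 < w i)%N.
Hypothesis w_le : forall i, (w i <= d)%N.

(** The closure of the forms of bounded strength, in the coordinates of a
    finite-dimensional space. *)
Definition border_rows : set 'rV[K]_#|{: bmultinom p d.+1}| :=
  zariski_closure [set coef_row d.+1 P | P in @wstrength K d r e w p].

Lemma wborder_coef_rowK P : wborder d e w P -> poly_of_row (coef_row d.+1 P) = P :> {mpoly K[p]}.
Proof. by move=> PX; apply: coef_rowK => m dm; apply: (wborder_mdeg e_bnd _ PX). Qed.

Lemma border_rowsP x : border_rows x -> wborder d e w (poly_of_row x).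
Proof.
apply: (zariski_closure_linear (L := @poly_of_row K p d.+1)) => _ [P PX <-] /=.
by rewrite wborder_coef_rowK //; apply: subset_zariski_closure.
Qed.

Lemma coef_row_border P : wborder d e w P -> border_rows (coef_row d.+1 P).
Proof.
by apply: (zariski_closure_linear (L := @coef_row K p d.+1)) => G GX; exists G.
Qed.

(** Two sums of products are joined by a curve of sums of products: each factor moves
    along a segment. *)
Lemma border_rows_irreducible : irreducible_affine_variety border_rows.
Proof.
split; first exact: zariski_closed_closure.
apply/irreducible_zariski_closure/irreducible_by_curves => //.
  exists (coef_row d.+1 0), 0 => //; exists (fun=> 0), (fun=> 0).
  by split=> [i|i|]; rewrite ?dhomog0 // big1 // => i _; rewrite mul0r.
move=> _ _ [_ [g [h [gh hh ->]]] <-] [_ [g' [h' [gh' hh' ->]]] <-].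
pose G i (t : 'rV[K]_1) := g i + entry ord0 t *: (g' i - g i).
pose H i (t : 'rV[K]_1) := h i + entry ord0 t *: (h' i - h i).
have pol (u v : {mpoly K[p]}) :
    polynomial_map (fun t : 'rV[K]_1 => u + entry ord0 t *: v).
  apply: PolynomialMapAdd (polynomial_map_cst _ _) _; apply: PolynomialMapTerm.
  exact: polynomial_fun_scalar.
exists (fun t => coef_row d.+1 (\sum_i G i t * H i t)).
  apply: (polynomial_map_linear (@coef_row K p d.+1)).
  by apply: polynomial_map_sum => i _; apply: polynomial_map_mul; apply: pol.
split.
- congr coef_row; apply: eq_bigr => i _.
  by rewrite /G /H /entry mxE !scale0r !addr0.
- congr coef_row; apply: eq_bigr => i _.
  by rewrite /G /H /entry mxE !scale1r !subrKC.
- move=> t; exists (\sum_i G i t * H i t) => //; exists (G ^~ t), (H ^~ t); split=> // i.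
    by apply: rpredD => //; apply: rpredZ; apply: rpredB.
  by apply: rpredD => //; apply: rpredZ; apply: rpredB.
Qed.

Variable n : nat.

Definition form_part (F : {mpoly K[n]}) : dhomog n K d := DHomog (pihomogP mdeg d F).

Fact form_part_is_linear : linear form_part.
Proof. by move=> k F G; apply/val_inj; rewrite /= linearP. Qed.

HB.instance Definition _ := GRing.isLinear.Build K _ _ _ form_part form_part_is_linear.

Definition tuple_index : finType := ('I_p * bmultinom n d.+1)%type.

Definition vform (t : 'I_#|tuple_index|) : 'I_p := (enum_val t).1.
Definition vmon (t : 'I_#|tuple_index|) : 'X_{1..n} := bmnm (enum_val t).2.

Definition form_of_row (a : 'rV[K]_#|tuple_index|) (j : 'I_p) : {mpoly K[n]} :=
  \sum_(t | (vform t == j) && (mdeg (vmon t) == w j)) entry t a *: 'X_[vmon t].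

Lemma form_of_row_homog a j : form_of_row a j \is (w j).-homog.
Proof. by apply: rpred_sum => t /andP[_ /eqP tw]; apply: rpredZ; rewrite dhomogX; apply/eqP. Qed.

Lemma form_of_row_surj (V : 'I_p -> {mpoly K[n]}) : (forall j, V j \is (w j).-homog) ->
  exists a, forall j, form_of_row a j = V j.
Proof.
move=> Vh; exists (\row_t (V (vform t))@_(vmon t)) => j.
apply/mpolyP => M; rewrite raddf_sum /=.
have [Mw|Mw] := eqVneq (mdeg M) (w j); last first.
  rewrite (dhomog_nemf_coeff (Vh j) Mw) big1 // => t /andP[_ /eqP tw].
  rewrite mcoeffZ mcoeffX; case: eqP => [tM|]; rewrite ?mulr0 //.
  by case/eqP: Mw; rewrite -tM tw.
have Md : (mdeg M < d.+1)%N by rewrite Mw ltnS w_le.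
rewrite (bigD1 (enum_rank (j, BMultinom Md))) ?/vform ?/vmon /= ?enum_rankK /= ?eqxx ?Mw ?eqxx //.
rewrite mcoeffZ mcoeffX /entry mxE /vform /vmon enum_rankK /= eqxx mulr1 big1 ?addr0 //.
move=> t /andP[/andP[/eqP tj _] tM]; rewrite mcoeffZ mcoeffX.
case: eqP => [tE|]; rewrite ?mulr0 //; case/eqP: tM; apply: enum_val_inj; rewrite enum_rankK.
by rewrite [LHS]surjective_pairing tj; congr (_, _); apply: val_inj.
Qed.

Definition evaluation (x : 'rV[K]_#|{: bmultinom p d.+1}| * 'rV[K]_#|tuple_index|) : dhomog n K d :=
  form_part (poly_of_row x.1 \mPo [tuple form_of_row x.2 j | j < p]).

Lemma evaluation_polynomial : polynomial_map evaluation.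
Proof.
apply: (polynomial_map_linear form_part
  (Phi := fun x => poly_of_row x.1 \mPo [tuple form_of_row x.2 j | j < p])).
apply: polynomial_map_comp_mpoly => [|j].
  apply: polynomial_map_sum => a _; apply: PolynomialMapTerm.
  exact: (polynomial_fun_comp_linear fst (polynomial_fun_scalar (entry a))).
apply: polynomial_map_sum => t _; apply: PolynomialMapTerm.
exact: (polynomial_fun_comp_linear snd (polynomial_fun_scalar (entry t))).
Qed.

Lemma evaluation_border x : border_rows x.1 ->
  wborder d e (fun=> 1%N) (mpoly_of_dhomog (evaluation x)).
Proof.
move=> /border_rowsP X.
have Y : wborder d e (fun=> 1%N) (poly_of_row x.1 \mPo [tuple form_of_row x.2 j | j < p]).
  by apply: wborder_comp X => j; rewrite wdeg1_homog form_of_row_homog.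
rewrite /= pihomog_dE // -wdeg1_homog; exact: wborder_homog Y.
Qed.

End Parametrization.

Section FormSpace.
Variables (K : closedFieldType) (d r : nat) (e : 'I_r -> nat) (V : vectType K).
Hypothesis e_bnd : forall i, (1 <= e i <= d - 1)%N.

Lemma strength_setP (f : form V d) :
  strength_set d e V f <-> wstrength d e (fun=> 1%N) (mpoly_of_dhomog f).
Proof.
split=> [[g [h fE]]|[g [h [gh hh fE]]]].
  exists (fun i => mpoly_of_dhomog (g i)), (fun i => mpoly_of_dhomog (h i)).
  by split=> // i; rewrite wdeg1_homog dhomog_is_dhomog.
have {}gh i : g i \is (e i).-homog by rewrite -wdeg1_homog.
have {}hh i : h i \is (d - e i).-homog by rewrite -wdeg1_homog.
by exists (fun i => DHomog (gh i)), (fun i => DHomog (hh i)).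
Qed.

Lemma zariski_closure_strength_setP (f : form V d) :
  zariski_closure (strength_set d e V) f <-> wborder d e (fun=> 1%N) (mpoly_of_dhomog f).
Proof.
split.
  apply: (zariski_closure_linear (L := @mpoly_of_dhomog _ K d)) => g.
  by move/strength_setP.
move=> /(zariski_closure_linear (L := @form_part K d (\dim {:V}))
  (Y := strength_set d e V)) H.
have -> : f = form_part d (mpoly_of_dhomog f).
  by apply/val_inj; rewrite /= pihomog_dE // dhomog_is_dhomog.
apply: H => g gX; apply/strength_setP.
by rewrite /= pihomog_dE // -wdeg1_homog; apply: wstrength_homog gX.
Qed.

End FormSpace.

Theorem theorem1p1 (K : closedFieldType) (charK0 : [pchar K] =i pred0)
    (d r : nat) (d_ge2 : (2 <= d)%N) (r_ge1 : (1 <= r)%N)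
    (e : 'I_r -> nat) (e_bnd : forall i, (1 <= e i <= d - 1)%N) :
  exists (N : nat) (B : set 'rV[K]_N),
    irreducible_affine_variety B /\
    forall V : vectType K,
      exists (m : nat) (phi : 'rV[K]_N * 'rV[K]_m -> form V d),
        variety_morphism (B `*` [set: 'rV[K]_m])
          (zariski_closure (strength_set d e V)) phi /\
        set_surj (B `*` [set: 'rV[K]_m])
          (zariski_closure (strength_set d e V)) phi.
Proof.
have d_gt0 : (0 < d)%N := ltnW d_ge2.
have [M MP] := border_parametrized charK0 e_bnd d_gt0.
pose w := cyclic_weight d; pose p := (d * M)%N.
have w_gt0 i : (0 < w i)%N by [].
have w_le i : (w i <= d)%N by rewrite /w /cyclic_weight ltn_mod.
exists _, (@border_rows K d r e w p); split; first exact: border_rows_irreducible.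
move=> V; exists _, (@evaluation K d w p (\dim {:V})); split; first split.
- move=> x [xB _]; apply/(zariski_closure_strength_setP e_bnd).
  exact: evaluation_border.
- move=> g pg; exists (g \o evaluation w (p := p) (n := \dim {:V})) => //.
  exact: polynomial_fun_comp pg (evaluation_polynomial _ _ _ _ _).
move=> f /(zariski_closure_strength_setP e_bnd) fX.
have [P [U [PX Uh fE]]] := MP _ _ (dhomog_is_dhomog f) fX.
have [a aU] := form_of_row_surj w_le Uh.
exists (coef_row d.+1 P, a); first by split=> //=; apply: coef_row_border.
apply/val_inj; rewrite /= (wborder_coef_rowK e_bnd w_gt0 PX).
rewrite (_ : [tuple _ | _ < _] = [tuple U j | j < p]); last exact: eq_mktuple.
by rewrite -fE pihomog_dE // dhomog_is_dhomog.
Qed.
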